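(* For every index $\boldsymbol{k}=(k_1,\dots,k_r)$, every $m\geqslant0$ and every regularization parameter $T\in\mathbb C$, $$\Theta_{*,m}^T(\boldsymbol{k})=\delta_{m,0}\cdot c_0(\boldsymbol{k});$$ equivalently, $$\Theta_{*,m}^T(\boldsymbol{k})=\begin{cases}\dfrac{(i\pi)^r}{r!},&\boldsymbol{k}=\{1\}^r,\ m=0,\ 2\mid r,\\ 0,&\text{otherwise}.\end{cases}$$
   Context: An index is a finite sequence $\boldsymbol{k}=(k_1,\dots,k_r)$ of positive integers, of depth $r$ and weight $|\boldsymbol{k}|=k_1+\cdots+k_r$; the empty index is $\varnothing$ (weight $0$); $\{1\}^r=(1,\dots,1)$ ($r$ entries). Reversal: $\overleftarrow{\boldsymbol{k}}=(k_r,\dots,k_1)$. Write $\boldsymbol{k}_{[1,j]}=(k_1,\dots,k_j)$, $\boldsymbol{k}_{(j,r]}=(k_{j+1},\dots,k_r)$, $\boldsymbol{k}_{[1,j)}=(k_1,\dots,k_{j-1})$, with $\boldsymbol{k}_{[1,0]}=\boldsymbol{k}_{(r,r]}=\boldsymbol{k}_{[1,1)}=\varnothing$. An index is admissible if it is empty or its last entry is $\geqslant2$. Stuffle-regularized multiple zeta values. For a nonempty admissible index $\boldsymbol{a}=(a_1,\dots,a_d)$, $\zeta(\boldsymbol{a})=\sum_{0<n_1<\cdots<n_d}\prod_{i}n_i^{-a_i}$, and $\zeta(\varnothing)=1$. On the $\mathbb Q$-span of all indices, the stuffle product $*$ is bilinear with unit $\varnothing$ and $(a,\boldsymbol{\alpha})*(b,\boldsymbol{\beta})=(a,\boldsymbol{\alpha}*(b,\boldsymbol{\beta}))+(b,(a,\boldsymbol{\alpha})*\boldsymbol{\beta})+(a+b,\boldsymbol{\alpha}*\boldsymbol{\beta})$.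 It is known that every index of depth $r$ has a unique decomposition $\boldsymbol{k}=\sum_{l=0}^r\boldsymbol{u}_l*(1)^{*l}$ with each $\boldsymbol{u}_l$ in the span of admissible indices. Define $\zeta_*^T(\boldsymbol{k})=\sum_{l=0}^r\zeta(\boldsymbol{u}_l)T^l$ (with $\zeta$ extended linearly), and, for $m\geqslant0$, $$\zeta_{*,m}^T(\boldsymbol{k})=\sum_{\substack{\lambda_1+\cdots+\lambda_r=m\\ \lambda_\nu\geqslant0}}\Bigl(\prod_{\nu=1}^r\tbinom{-k_\nu}{\lambda_\nu}\Bigr)\zeta_*^T(k_1+\lambda_1,\dots,k_r+\lambda_r),\qquad \zeta_{*,m}^T(\varnothing)=\delta_{m,0}.$$ For $m\geqslant0$ and $1\leqslant j\leqslant r$ put $$A_m^T(\boldsymbol{k})=\sum_{j=0}^{r}(-1)^{|\boldsymbol{k}_{[1,j]}|}\sum_{\substack{a+b=m\\ a,b\geqslant0}}(-1)^a\zeta_{*,a}^T\bigl(\overleftarrow{\boldsymbol{k}_{[1,j]}}\bigr)\zeta_{*,b}^T\bigl(\boldsymbol{k}_{(j,r]}\bigr),$$ $$B_{j,m}^T(\boldsymbol{k})=(-1)^{|\boldsymbol{k}_{[1,j)}|}\sum_{\substack{a+b=m\\ a,b\geqslant0}}(-1)^a\zeta_{*,a}^T\bigl(\overleftarrow{\boldsymbol{k}_{[1,j)}}\bigr)\zeta_{*,b}^T\bigl(\boldsymbol{k}_{(j,r]}\bigr).$$ For $k\geqslant1$, $m\geqslant0$ put $\mu_0(1)=0$ and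 $\mu_m(k)=\bigl(1+(-1)^{k+m}\bigr)\binom{-k}{m}\zeta(k+m)$ if $k+m>1$. Then $$\Theta_{*,m}^T(\boldsymbol{k})=A_m^T(\boldsymbol{k})+\sum_{j=1}^{r}B_{j,k_j+m}^T(\boldsymbol{k})-\sum_{j=1}^{r}\sum_{h=0}^{k_j-1}B_{j,h}^T(\boldsymbol{k})\,\mu_m(k_j-h).$$ Finally $c_0(\boldsymbol{k})=\frac{(i\pi)^r}{r!}$ if $\boldsymbol{k}=\{1\}^r$ with $r$ even, and $c_0(\boldsymbol{k})=0$ otherwise. *)

(* Defs.v *)
From HB Require Import structures.
From mathcomp Require Import all_boot all_order all_algebra.
From mathcomp Require Import complex.
From mathcomp Require Import all_classical all_reals all_analysis.
From mathcomp Require Import freeg.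

Set Implicit Arguments.
Unset Strict Implicit.
Unset Printing Implicit Defensive.

Import Order.TTheory GRing.Theory Num.Theory.

Local Open Scope classical_set_scope.
Local Open Scope ring_scope.
Local Open Scope complex_scope.

(* Indices are sequences of naturals satisfying [is_index]. *)
Definition is_index (k : seq nat) : bool := all (fun x => 0 < x)%N k.

Definition admissible (k : seq nat) : bool :=
  is_index k && ((k == [::]) || (2 <= last 0 k)%N).

(* The rational vector space with basis the finite sequences of naturals; it
   contains the span of all indices as the elements supported on [is_index]. *)
Notation index_span := {freeg (seq nat) / rat}.

Definition admissible_span (u : index_span) : bool := all admissible (dom u).

Definition prepend (a : nat) : index_span -> index_span :=
  fglift (fun w : seq nat => << a :: w >>).

Fixpoint stuffle_basis (u : seq nat) : seq nat -> index_span :=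
  fix stuffle_u (v : seq nat) : index_span :=
    match u, v with
    | [::], _ => << v >>
    | _, [::] => << u >>
    | a :: u', b :: v' =>
        prepend a (stuffle_basis u' v) + prepend b (stuffle_u v')
        + prepend (a + b) (stuffle_basis u' v')
    end.

Definition stuffle (x y : index_span) : index_span :=
  fglift (fun u => fglift (stuffle_basis u) y) x.

Definition stuffle_exp (x : index_span) (l : nat) : index_span :=
  iter l (stuffle x) << [::] >>.

(* The terms are nonnegative, so the sum over all 0 < n_1 < ... < n_d is the
   unordered sum [esum]; it is finite when [a] is admissible, the only case
   used. For [a = [::]] it has the single term 1. *)
Definition zeta (R : realType) (a : seq nat) : R :=
  fine (\esum_(n in [set n : (size a).-tuple nat | path ltn 0%N n])
          (\prod_(i < size a) ((tnth n i)%:R ^- nth 0%N a i : R))%:E).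

Definition zeta_span (R : realType) (u : index_span) : R :=
  \sum_(w <- dom u) ratr (coeff w u) * zeta R w.

Definition is_stuffle_decomposition (k : seq nat)
    (u : {ffun 'I_(size k).+1 -> index_span}) : Prop :=
  (forall l, admissible_span (u l)) /\
  << k >> = \sum_l stuffle (u l) (stuffle_exp << [:: 1%N] >> l).

(* Every index has exactly one decomposition, so for indices the choice is
   forced and the default value is not used. *)
Definition stuffle_decomposition (k : seq nat) :
    {ffun 'I_(size k).+1 -> index_span} :=
  xget [ffun=> 0] [set u | is_stuffle_decomposition u].

Definition zeta_star (R : realType) (T : R[i]) (k : seq nat) : R[i] :=
  \sum_(l < (size k).+1)
     (zeta_span R (stuffle_decomposition k l))%:C * T ^+ l.

(* The binomial coefficient with arbitrary upper argument,
   x (x - 1) ... (x - n + 1) / n! *)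
Definition gbinom (F : fieldType) (x : F) (n : nat) : F :=
  (\prod_(i < n) (x - i%:R)) / n`!%:R.

(* The lambda_i are at most m since they sum to m. For [k = [::]] the sum has
   one term if m = 0 and none otherwise. *)
Definition zeta_star_m (R : realType) (T : R[i]) (m : nat) (k : seq nat)
    : R[i] :=
  \sum_(lam : {ffun 'I_(size k) -> 'I_m.+1} | (\sum_i (lam i : nat))%N == m)
     (\prod_(i < size k) gbinom (- (nth 0%N k i)%:R) (lam i))
     * zeta_star T [seq (nth 0%N k i + lam i)%N | i : 'I_(size k)].

Definition theta_A (R : realType) (T : R[i]) (m : nat) (k : seq nat) : R[i] :=
  \sum_(j < (size k).+1)
     (-1) ^+ sumn (take j k) *
     \sum_(a < m.+1) (-1) ^+ a * zeta_star_m T a (rev (take j k))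
                       * zeta_star_m T (m - a) (drop j k).

(* Here 1 <= j <= size k. *)
Definition theta_B (R : realType) (T : R[i]) (j m : nat) (k : seq nat) : R[i] :=
  (-1) ^+ sumn (take j.-1 k) *
  \sum_(a < m.+1) (-1) ^+ a * zeta_star_m T a (rev (take j.-1 k))
                    * zeta_star_m T (m - a) (drop j k).

(* For k >= 1 the condition k + m > 1 only excludes (k, m) = (1, 0). *)
Definition mu (R : realType) (m k : nat) : R[i] :=
  if (1 < k + m)%N then
    (1 + (-1) ^+ (k + m)) * gbinom (- k%:R) m * (zeta R [:: (k + m)%N])%:C
  else 0.

(* [nth 0 k j.-1] is the j-th entry k_j of the index. *)
Definition Theta (R : realType) (T : R[i]) (m : nat) (k : seq nat) : R[i] :=
  theta_A T m k
  + \sum_(1 <= j < (size k).+1) theta_B T j (nth 0%N k j.-1 + m) k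
  - \sum_(1 <= j < (size k).+1) \sum_(0 <= h < nth 0%N k j.-1)
      theta_B T j h k * mu R m (nth 0%N k j.-1 - h).

Definition c0 (R : realType) (k : seq nat) : R[i] :=
  if (k == nseq (size k) 1%N) && ~~ odd (size k) then
    ('i * (pi : R)%:C) ^+ size k / (size k)`!%:R
  else 0.

(* Main.v *)
Require Import Defs.
From HB Require Import structures.
From mathcomp Require Import all_boot all_order all_algebra.
From mathcomp Require Import complex.
From mathcomp Require Import all_classical all_reals all_analysis.
From mathcomp Require Import freeg ring lra zify.

(** The sum of prod_i 1/(s + n_i)^(k_i) over 0 < n_1 < ... < n_r has, as the
    coefficient of s^m, the sum defining zeta_(star,m)(k). Reversing an index
    and changing signs moves the variables to the negative integers. Hence
    A_m + sum_j B_(j,k_j+m) is the coefficient of s^m in a regularized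
    multitangent function, the sum over n_1 < ... < n_r in Z, the j-th term
    being the part where n_j = 0; the B_(j,h) with h < k_j are the
    coefficients of its principal part at s = 0, and mu_m(e) is the
    coefficient of s^m in the sum of 1/(s + n)^e over the integers n other
    than 0. So Theta is the expansion of the multitangent function minus its
    principal parts at all integers, and the theorem says that this is the
    constant c0.

    For the finite window -Q <= n_i <= Q this is a matter of partial fractions
    ([partial_fractions], [partial_fractions_at_pole]): the nested sum equals
    the sum over the nodes n of its principal parts, and the principal part at
    n is the one at 0 of a nested sum over the translated window. Truncated
    Theta is therefore a sum over n of differences of residues times the
    coefficient of s^m in 1/(s + n)^e ([window_polar_diff]). The residues are
    products of truncated sums over Q + n and Q - n terms, so their difference
    with the case n = 0 is, up to powers of log Q, at most
    |n|/(Q + 1 - |n|), and paired with a weight of order 1/n^2 it disappears in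
    the limit ([window_tiny]). This settles m > 0. For m = 0 the weight 1/n
    has to be compensated: with Q = M^2, the difference 1/n - 1/(n + iM) is
    of order M/n^2, so that Theta may be evaluated at iM, and also at -iM. In
    the sum of the two values the simple poles cancel by symmetry, the others
    are small, and there remain the nested sums of the 1/(n + iM) and of the
    1/(n - iM). These are small as soon as an entry of k is at least 2
    ([nsum_vrecips_tiny]); for k = (1, ..., 1) they are elementary symmetric
    functions, tending to (-i pi)^r/r! and (i pi)^r/r! because the sum of the
    1/(n + iM) tends to -i pi ([nsum_vrecips_ones_tiny]). Their mean is c0.

    It remains to pass from truncated sums to regularized values. Truncated
    sums multiply by the stuffle product, so the decomposition of k that
    defines zeta_star, whose existence is [decomposable_index], expresses the
    truncated sum of k as the same polynomial at T = H_Q = 1 + ... + 1/Q, with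
    each zeta(u_l) replaced by its truncation. The error is of order
    log^J Q / sqrt Q ([zeta_harm_tiny]), hence still small after
    multiplication by polynomials in H_Q ([zeta_star_close]). Thus Theta, a
    polynomial in T, tends to c0 along T = H_Q, which is unbounded; it is
    constant ([tiny_poly_eq0]). *)

Set Implicit Arguments.
Unset Strict Implicit.
Unset Printing Implicit Defensive.

Import Order.TTheory GRing.Theory Num.Theory numFieldNormedType.Exports.

Local Open Scope ring_scope.

(** * Nested sums *)

Section NestedSums.
Variable A : comNzRingType.
Implicit Types (x : A) (xs ys : seq A) (k u v : seq nat).

(** The monomial quasi-symmetric polynomial of [k] at [xs]: the sum of
    prod_j x_(i_j)^(k_j) over positions i_1 < ... < i_r. Truncated multiple
    harmonic sums, nested Hurwitz sums and multitangent sums are all of this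
    form, over various rings. *)
Fixpoint nsum xs k {struct xs} : A :=
  if xs is x :: xs' then
    nsum xs' k + (if k is a :: k' then x ^+ a * nsum xs' k' else 0)
  else (k == [::])%:R.

Lemma nsum_nil xs : nsum xs [::] = 1.
Proof. by elim: xs => [|x xs IH] //=; rewrite IH addr0. Qed.

Lemma nsum_cons x xs a k :
  nsum (x :: xs) (a :: k) = nsum xs (a :: k) + x ^+ a * nsum xs k.
Proof. by []. Qed.

Lemma nsum_rcons xs x k a :
  nsum (rcons xs x) (rcons k a) = nsum xs (rcons k a) + nsum xs k * x ^+ a.
Proof.
elim: xs k => [|y xs IH] [|b k] /=.
- by rewrite mulrC.
- by case: k => [|c k] /=; rewrite ?mulr0 mul0r !addr0.
- by rewrite (IH [::]) !nsum_nil addr0 !mul1r addrAC.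
- rewrite (IH (b :: k)) IH mulrDr mulrDl !addrA; congr (_ + _).
  - by rewrite addrAC.
  - by rewrite mulrA.
Qed.

Lemma nsum_rev xs k : nsum (rev xs) (rev k) = nsum xs k.
Proof.
elim: xs k => [|x xs IH] [|a k]; rewrite ?nsum_nil //.
  by rewrite /= rev_cons -size_eq0 size_rcons.
by rewrite !rev_cons nsum_rcons -rev_cons !IH nsum_cons mulrC.
Qed.

Lemma nsum_opp xs k : nsum (map -%R xs) k = (-1) ^+ sumn k * nsum xs k.
Proof.
elim: xs k => [|x xs IH] [|a k] /=; rewrite ?mul1r ?mulr0 //.
  by rewrite !nsum_nil.
by rewrite !IH /= (exprNn x) exprD mulrDr; congr (_ + _); rewrite mulrACA.
Qed.

(** The entries of [k] placed in [xs] form a prefix. *)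
Lemma nsum_cat xs ys k :
  nsum (xs ++ ys) k =
  \sum_(j < (size k).+1) nsum xs (take j k) * nsum ys (drop j k).
Proof.
elim: xs k => [|x xs IH] k.
  rewrite big_ord_recl /= take0 drop0 mul1r big1 ?addr0 // => i _.
  by case: k i => [[]|a k i] //=; rewrite mul0r.
case: k => [|a k]; first by rewrite big_ord_recl big_ord0 addr0 !nsum_nil mulr1.
rewrite /= !IH [in LHS]big_ord_recl [in RHS]big_ord_recl /= !nsum_nil addr0 -addrA.
congr (_ + _).
rewrite mulr_sumr -big_split /=; apply: eq_bigr => i _.
by rewrite /= add0n mulrDl mulrA.
Qed.

End NestedSums.

Lemma nsum_rmorph (A B : comNzRingType) (f : {rmorphism A -> B}) xs k :
  f (nsum xs k) = nsum (map f xs) k.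
Proof.
elim: xs k => [|x xs IH] k /=; first by rewrite rmorph_nat.
by rewrite rmorphD IH; case: k => [|a k]; rewrite ?rmorph0 // rmorphM rmorphXn IH.
Qed.

(** Forgetting the order of the positions only adds nonnegative terms. *)
Lemma normr_nsum_le (F : numFieldType) (xs : seq F) (k : seq nat) :
  `|nsum xs k| <= \prod_(a <- k) \sum_(x <- xs) `|x| ^+ a.
Proof.
elim: xs k => [|x xs IH] k.
  case: k => [|a k] /=; first by rewrite big_nil normr1.
  by rewrite normr0 big_cons big_nil mul0r.
have P0 k' : 0 <= \prod_(a <- k') \sum_(x <- xs) `|x| ^+ a.
  by apply: prodr_ge0 => i _; apply: sumr_ge0 => y _; rewrite exprn_ge0.
case: k => [|a k]; first by rewrite nsum_nil big_nil normr1.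
rewrite nsum_cons (le_trans (ler_normD _ _)) // big_cons big_cons mulrDl addrC.
have H k' : \prod_(a <- k') \sum_(x <- xs) `|x| ^+ a <=
            \prod_(a <- k') \sum_(y <- x :: xs) `|y| ^+ a.
  apply: ler_prod => i _; apply/andP; split.
    by apply: sumr_ge0 => y _; rewrite exprn_ge0.
  by rewrite big_cons lerDr exprn_ge0.
apply: lerD.
  rewrite normrM normrX; apply: ler_wpM2l; rewrite ?exprn_ge0 //.
  exact: le_trans (IH _) (H _).
apply: le_trans (IH _) _; rewrite big_cons; apply: ler_wpM2l; last exact: H.
by apply: sumr_ge0 => y _; rewrite exprn_ge0.
Qed.

(** * Formal power series *)

Definition fps (K : Type) := nat -> K.

Section PowerSeries.
Variable K : comNzRingType.

HB.instance Definition _ := gen_eqMixin (fps K).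
HB.instance Definition _ := gen_choiceMixin (fps K).

Implicit Types f g h : fps K.

Let addf f g : fps K := fun n => f n + g n.
Let oppf f : fps K := fun n => - f n.
Let zerof : fps K := fun=> 0.

Fact fps_addA : associative addf.
Proof. by move=> f g h; apply/funext => n; rewrite /addf addrA. Qed.
Fact fps_addC : commutative addf.
Proof. by move=> f g; apply/funext => n; rewrite /addf addrC. Qed.
Fact fps_add0 : left_id zerof addf.
Proof. by move=> f; apply/funext => n; rewrite /addf add0r. Qed.
Fact fps_addN : left_inverse zerof oppf addf.
Proof. by move=> f; apply/funext => n; rewrite /addf addNr. Qed.

HB.instance Definition _ :=
  GRing.isZmodule.Build (fps K) fps_addA fps_addC fps_add0 fps_addN.

Lemma fps0E n : (0 : fps K) n = 0. Proof. by []. Qed.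
Lemma fpsDE f g n : (f + g) n = f n + g n. Proof. by []. Qed.
Lemma fpsNE f n : (- f) n = - f n. Proof. by []. Qed.

Definition fps_mul f g : fps K := fun n => \sum_(i < n.+1) f i * g (n - i)%N.
Definition fps_one : fps K := fun n => (n == 0%N)%:R.

Let trunc f N : {poly K} := \poly_(i < N) f i.

(** A coefficient of a product only involves truncations, so the ring laws
    are inherited from polynomials. *)
Fact fps_mul_trunc f g N n : (n < N)%N ->
  fps_mul f g n = (trunc f N * trunc g N)`_n.
Proof.
move=> nN; rewrite coefM; apply: eq_bigr => i _.
by rewrite !coef_poly (leq_ltn_trans _ nN) ?(leq_ltn_trans _ nN) ?leq_subr // -ltnS.
Qed.

Fact fps_mulC : commutative fps_mul.
Proof.
by move=> f g; apply/funext => n; rewrite !(@fps_mul_trunc _ _ n.+1) // mulrC.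
Qed.

Fact coefM_eq (p p' q q' : {poly K}) n :
  (forall i, (i <= n)%N -> p`_i = p'`_i) -> (forall i, (i <= n)%N -> q`_i = q'`_i) ->
  (p * q)`_n = (p' * q')`_n.
Proof.
move=> Ep Eq; rewrite !coefM; apply: eq_bigr => i _.
by rewrite Ep ?Eq ?leq_subr // -ltnS.
Qed.

Fact trunc_mul f g N i : (i < N)%N ->
  (trunc (fps_mul f g) N)`_i = (trunc f N * trunc g N)`_i.
Proof. by move=> iN; rewrite coef_poly iN; apply: fps_mul_trunc. Qed.

Fact fps_mulA : associative fps_mul.
Proof.
move=> f g h; apply/funext => n; rewrite !(@fps_mul_trunc _ _ n.+1) //.
rewrite (@coefM_eq _ (trunc f n.+1) _ (trunc g n.+1 * trunc h n.+1)) //; last first.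
  by move=> i ?; apply: trunc_mul.
rewrite mulrA; apply: coefM_eq => // i ?; exact/esym/trunc_mul.
Qed.

Fact fps_mul1 : left_id fps_one fps_mul.
Proof.
move=> f; apply/funext => n; rewrite /fps_mul big_ord_recl mul1r subn0 big1 ?addr0 //.
by move=> i _; rewrite mul0r.
Qed.

Fact fps_mulD : left_distributive fps_mul +%R.
Proof.
move=> f g h; apply/funext => n; rewrite fpsDE /fps_mul -big_split /=.
by apply: eq_bigr => i _; rewrite fpsDE mulrDl.
Qed.

Fact fps_oner_neq0 : fps_one != 0.
Proof. by apply/eqP => /(congr1 (@^~ 0%N)) /eqP; rewrite /fps_one /= oner_eq0. Qed.

HB.instance Definition _ := GRing.Zmodule_isComNzRing.Build (fps K)
  fps_mulA fps_mulC fps_mul1 fps_mulD fps_oner_neq0.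

Lemma fps1E n : (1 : fps K) n = (n == 0%N)%:R. Proof. by []. Qed.
Lemma fpsME f g n : (f * g) n = \sum_(i < n.+1) f i * g (n - i)%N.
Proof. by []. Qed.

Lemma fps_sumE I (r : seq I) (P : pred I) (F : I -> fps K) n :
  (\sum_(i <- r | P i) F i) n = \sum_(i <- r | P i) F i n.
Proof. exact: (big_morph (fun f : fps K => f n)). Qed.

Definition fpsX : fps K := fun n => (n == 1%N)%:R.
Definition fpsC (c : K) : fps K := fun n => if n == 0%N then c else 0.

Lemma fpsXM f n : (fpsX * f) n = if n is m.+1 then f m else 0.
Proof.
rewrite fpsME; case: n => [|n]; first by rewrite big_ord_recl big_ord0 mul0r addr0.
rewrite !big_ord_recl /= /fpsX mul0r mul1r add0r subSS subn0 big1 ?addr0 //.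
by move=> i _; rewrite mul0r.
Qed.

Lemma fpsCM c f n : (fpsC c * f) n = c * f n.
Proof.
rewrite fpsME big_ord_recl subn0 big1 ?addr0 // => i _; by rewrite /fpsC /= mul0r.
Qed.

(** Substituting -s for the variable s. *)
Definition fps_flip f : fps K := fun n => (-1) ^+ n * f n.

Fact fps_flip_additive : {morph fps_flip : f g / f - g}.
Proof.
by move=> f g; apply/funext => n; rewrite /fps_flip !(fpsDE, fpsNE) mulrBr.
Qed.
Fact fps_flip_multiplicative : monoid_morphism fps_flip.
Proof.
split=> [|f g]; apply/funext => n; rewrite /fps_flip.
  by rewrite !fps1E; case: n => [|n]; rewrite ?mul1r ?mulr0.
rewrite !fpsME mulr_sumr; apply: eq_bigr => i _.
have {1}-> : n = (i + (n - i))%N by rewrite subnKC // -ltnS.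
by rewrite exprD; ring.
Qed.
HB.instance Definition _ := GRing.isZmodMorphism.Build (fps K) (fps K) fps_flip
  fps_flip_additive.
HB.instance Definition _ := GRing.isMonoidMorphism.Build (fps K) (fps K) fps_flip
  fps_flip_multiplicative.

Definition fps_const_coef f : K := f 0%N.
Fact fps_const_coef_additive : {morph fps_const_coef : f g / f - g}.
Proof. by []. Qed.
Fact fps_const_coef_multiplicative : monoid_morphism fps_const_coef.
Proof. by split=> [|f g] //; rewrite /fps_const_coef fpsME big_ord_recl big_ord0 addr0. Qed.
HB.instance Definition _ := GRing.isZmodMorphism.Build (fps K) K fps_const_coef
  fps_const_coef_additive.
HB.instance Definition _ := GRing.isMonoidMorphism.Build (fps K) K fps_const_coef
  fps_const_coef_multiplicative.

End PowerSeries.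

(** * Partial fractions of nested sums *)

Section PartialFractions.
Variable K : fieldType.
Implicit Types (a c d n : K) (ns l r : seq K) (F : fps K) (k : seq nat).

(** The expansion of 1/(s + n). *)
Definition yinv n : fps K := fun i => (-1) ^+ i * n^-1 ^+ i.+1.

Lemma yinvK n : n != 0 -> (fpsX K + fpsC n) * yinv n = 1.
Proof.
move=> n0; apply/funext => i.
rewrite mulrDl fpsDE fpsXM fpsCM fps1E /yinv.
case: i => [|i]; first by rewrite add0r mul1r expr1 mulfV.
by rewrite /= (exprS (-1) i) (exprS n^-1 i.+1) mulN1r mulNr mulrN mulrCA mulVKf // subrr.
Qed.

(** The relation (s + n) / (s + n)^(q+1) = 1 / (s + n)^q, read on
    coefficients. *)
Lemma yinvXS F n q i : n != 0 ->
  n * (F * yinv n ^+ q.+1) i =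
  (F * yinv n ^+ q) i - (if i is j.+1 then (F * yinv n ^+ q.+1) j else 0).
Proof.
move=> n0; have -> : F * yinv n ^+ q = (fpsX K + fpsC n) * (F * yinv n ^+ q.+1).
  by rewrite exprS mulrA mulrCA mulrA mulrCA mulrA yinvK // mul1r.
by rewrite mulrDl fpsDE fpsXM fpsCM addrAC subrr add0r.
Qed.

Lemma two_pole_step (f : nat -> K) d (c c' : nat -> K) p :
    d * c 0%N = c' 0%N -> (forall h, d * c h.+1 = c' h.+1 - c h) ->
  d * (\sum_(h < p.+1) c h * f (p.+1 - h)%N) =
  \sum_(h < p.+1) c' h * f (p.+1 - h)%N - \sum_(h < p) c h * f (p - h)%N.
Proof.
move=> e0 eS; rewrite mulr_sumr !big_ord_recl -addrA mulrA e0; congr (_ + _).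
rewrite -sumrB; apply: eq_bigr => i _; rewrite /= /bump /= add1n subSS.
by rewrite mulrA eS mulrBl.
Qed.

(** Partial fractions of 1/((s + a)^p (s + b)^q) with d = b - a. Only the
    recursion obtained from (s + b) - (s + a) = d matters, so the statement
    is about any doubly indexed family obeying it: besides products of two
    powers, it covers the coefficients of F(s)/(s + a)^p shifted by q, where
    one of the nodes is 0 and is not invertible among power series. *)
Lemma two_pole (Z : nat -> nat -> K) d : d != 0 ->
    (forall p q, d * Z p.+1 q.+1 = Z p.+1 q - Z p q.+1) ->
  forall p q, (0 < p + q)%N ->
  Z p q = \sum_(h < p) (yinv d ^+ q) h * Z (p - h)%N 0%N
        + \sum_(h < q) (yinv (- d) ^+ p) h * Z 0%N (q - h)%N.
Proof.
move=> d0 ZE p q; have [s] := ubnP (p + q)%N; elim: s p q => // s IH.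
case=> [|p] [|q] //= ps _.
- rewrite big_ord0 add0r big_ord_recl expr0 fps1E mul1r big1 ?addr0 //.
  by move=> i _; rewrite fps1E mul0r.
- rewrite big_ord0 addr0 big_ord_recl expr0 fps1E mul1r big1 ?addr0 //.
  by move=> i _; rewrite fps1E mul0r.
apply: (mulfI d0); rewrite ZE mulrDr.
rewrite (IH p.+1 q) ?(IH p q.+1) //; try by lia.
have S1 := @two_pole_step (fun i => Z i 0%N) d (yinv d ^+ q.+1) (yinv d ^+ q) p.
rewrite S1; first last.
- by move=> h; have := yinvXS 1 q h.+1 d0; rewrite !mul1r.
- by have := yinvXS 1 q 0 d0; rewrite !mul1r subr0.
have nd0 : - d != 0 by rewrite oppr_eq0.
have S2 := @two_pole_step (Z 0%N) (- d) (yinv (-d) ^+ p.+1) (yinv (-d) ^+ p) q.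
rewrite -[X in _ = _ + X]opprK -mulNr S2; first last.
- by move=> h; have := yinvXS 1 p h.+1 nd0; rewrite !mul1r.
- by have := yinvXS 1 p 0 nd0; rewrite !mul1r subr0.
rewrite opprB opprD !addrA; congr (_ - _).
by rewrite addrAC.
Qed.

(** The principal part of (f g)/s^e, where the values of 1/s^i are replaced
    by arbitrary [x i], may be formed one factor at a time. *)
Lemma polar_mul (f g : fps K) (x : nat -> K) e :
  \sum_(h < e) (f * g) h * x (e - h)%N =
  \sum_(h < e) f h * \sum_(i < e - h) g i * x (e - h - i)%N.
Proof.
elim: e f => [|e IH] f; first by rewrite !big_ord0.
pose f' : fps K := fun h => f h.+1.
rewrite [LHS]big_ord_recl [RHS]big_ord_recl !subn0 /=.
rewrite -(IH f') [in RHS]big_ord_recl subn0 mulrDr.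
rewrite fpsME big_ord_recl big_ord0 addr0 subn0 mulrA -addrA; congr (_ + _).
rewrite mulr_sumr -big_split /=; apply: eq_bigr => i _.
rewrite /bump /= add1n subSS mulrA -mulrDl; congr (_ * _).
by rewrite fpsME big_ord_recl subn0.
Qed.

Definition shifted_nsum ns c k : fps K := nsum [seq yinv (n - c) | n <- ns] k.

(** The total contribution to the partial fraction expansion of the pole of
    node [n], when [l] and [r] are the nodes on its left and on its right:
    [n] receives some entry of [k], and the product of the nested sums over
    the other nodes is expanded around that pole. *)
Definition node_polar (xi : K -> nat -> K) n l r k : K :=
  \sum_(j < size k) \sum_(h < nth 0%N k j)
    (shifted_nsum l n (take j k) * shifted_nsum r n (drop j.+1 k)) h
    * xi n (nth 0%N k j - h)%N.

(** For the empty index the nested sum is 1, which has no pole; its value is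
    recorded as [xi 0 0]. *)
Definition polar_sum xi ns k : K :=
  if k is [::] then xi 0 0%N
  else \sum_(i < size ns) node_polar xi ns`_i (take i ns) (drop i.+1 ns) k.

Lemma eq_polar_sum xi xi' ns k :
    xi 0 0%N = xi' 0 0%N -> {in ns, forall n, xi n =1 xi' n} ->
  polar_sum xi ns k = polar_sum xi' ns k.
Proof.
move=> e0 e; case: k => //= a k; apply: eq_bigr => i _.
apply: eq_bigr => j _; apply: eq_bigr => h _; by rewrite e // mem_nth.
Qed.

(** The functional [xi n e] takes at 1/(s + n)^e is here the coefficient of
    s^g after multiplication by F and translation by c. *)
Definition pf_valid ns := forall c F k g, {in ns, forall n, n != c} ->
  is_index k ->
  (F * shifted_nsum ns c k) g =
  polar_sum (fun n e => (F * yinv (n - c) ^+ e) g) ns k.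

(** The value at 1/((s + a)^p (s + n)^e) of a linear functional with values
    [xi n e] at 1/(s + n)^e, as given by [two_pole]. *)
Definition absorb (xi : K -> nat -> K) a p n e : K :=
  \sum_(h < p) (yinv (n - a) ^+ e) h * xi a (p - h)%N
  + \sum_(h < e) (yinv (a - n) ^+ p) h * xi n (e - h)%N.

Lemma absorb0 xi a p n : (0 < p)%N -> absorb xi a p n 0 = xi a p.
Proof.
case: p => // p _; rewrite /absorb big_ord0 addr0 big_ord_recl expr0 fps1E mul1r subn0.
by rewrite big1 ?addr0 // => i _; rewrite fps1E mul0r.
Qed.

Lemma shifted_nsum0 ns c : shifted_nsum ns c [::] = 1.
Proof. exact: nsum_nil. Qed.

Lemma shifted_nsum_nil c k : k != [::] -> shifted_nsum [::] c k = 0.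
Proof. by case: k. Qed.

Lemma node_polar_cons xi n a l r p k :
  node_polar xi n (a :: l) r (p :: k) =
  node_polar xi n l r (p :: k)
  + node_polar (fun n e => \sum_(h < e) (yinv (a - n) ^+ p) h * xi n (e - h)%N) n l r k.
Proof.
rewrite /node_polar /= !big_ord_recl /= !shifted_nsum0 -addrA; congr (_ + _).
rewrite -big_split; apply: eq_bigr => j _ /=.
rewrite -polar_mul -big_split; apply: eq_bigr => h _ /=.
rewrite -mulrDl -fpsDE; congr (_ * _); apply: (congr1 (fun f : fps K => f h)).
rewrite /shifted_nsum /= mulrDl; congr (_ + _).
by rewrite [RHS]mulrC mulrA.
Qed.

Lemma node_polar_head xi n r p k :
  node_polar xi n [::] r (p :: k) =
  \sum_(h < p) (shifted_nsum r n k) h * xi n (p - h)%N.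
Proof.
rewrite /node_polar /= big_ord_recl /= drop0 shifted_nsum0 mul1r.
rewrite [X in _ + X]big1 ?addr0 // => i _; rewrite big1 // => h _.
by rewrite shifted_nsum_nil // mul0r fps0E mul0r.
Qed.

(** Either [a] receives no entry, or it receives the first one and 1/(s + a)^p
    multiplies every pole of the expansion for [ns] and [k]. In the second
    case the new pole at [a] collects one contribution from each pole of that
    expansion, and together they evaluate it around [a]: this is where its
    validity is used. *)
Lemma polar_sum_cons xi a ns p k : a \notin ns -> pf_valid ns -> is_index k ->
  polar_sum xi (a :: ns) (p :: k) =
  polar_sum xi ns (p :: k) + polar_sum (absorb xi a p) ns k.
Proof.
move=> ans pf ik.
rewrite [LHS]/= big_ord_recl /= drop0 node_polar_head.
under eq_bigr do rewrite /bump /= node_polar_cons.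
rewrite big_split /= addrCA; congr (_ + _).
have -> : \sum_(h < p) shifted_nsum ns a k h * xi a (p - h)%N =
  \sum_(h < p) polar_sum (fun n e => (yinv (n - a) ^+ e) h) ns k * xi a (p - h)%N.
  apply: eq_bigr => h _; congr (_ * _).
  have /(_ a 1 k h) := pf; rewrite mul1r => -> //.
    by apply: eq_polar_sum => [|n _ e]; rewrite mul1r.
  by move=> n nns; apply: contraNneq ans => <-.
case: k ik => [|b k] ik.
  rewrite /= /absorb big_ord0 addr0 [X in _ + X]big1 ?addr0; last first.
    by move=> i _; rewrite /node_polar big_ord0.
  by apply: eq_bigr => h _; rewrite !expr0.
rewrite /polar_sum; set kk := b :: k.
under [X in X + _]eq_bigr do rewrite mulr_suml.
rewrite exchange_big /= -big_split; apply: eq_bigr => i _ /=.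
rewrite /node_polar.
under [X in X + _]eq_bigr do rewrite mulr_suml.
rewrite exchange_big -big_split; apply: eq_bigr => j _ /=.
under [X in X + _]eq_bigr do rewrite mulr_suml.
rewrite exchange_big -big_split; apply: eq_bigr => h _ /=.
rewrite /absorb mulrDr; congr (_ + _).
by rewrite mulr_sumr; apply: eq_bigr => g _; rewrite mulrA.
Qed.

Lemma absorb_mul F c a p n e g : n != a -> a != c -> n != c -> (0 < p)%N ->
  absorb (fun n e => (F * yinv (n - c) ^+ e) g) a p n e =
  (F * yinv (a - c) ^+ p * yinv (n - c) ^+ e) g.
Proof.
move=> na ac nc p0; rewrite /absorb.
have ac0 : a - c != 0 by rewrite subr_eq0.
have nc0 : n - c != 0 by rewrite subr_eq0.
have na0 : n - a != 0 by rewrite subr_eq0.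
rewrite (@two_pole (fun p e => (F * yinv (a - c) ^+ p * yinv (n - c) ^+ e) g)
  (n - a) na0) ?addn_gt0 ?p0 //.
  rewrite opprB; congr (_ + _); apply: eq_bigr => h _; first by rewrite expr0 mulr1.
  by rewrite expr0 mulr1.
move=> {p p0}p q; have -> : n - a = (n - c) - (a - c) by ring.
have E1 := yinvXS (F * yinv (a - c) ^+ p.+1) q g nc0.
have E2 := yinvXS (F * yinv (n - c) ^+ q.+1) p g ac0.
rewrite mulrBl E1; case: g {E1} E2 => [|g];
  rewrite !(mulrAC F (yinv (n - c) ^+ q.+1)) => ->; first by rewrite !subr0.
by rewrite opprB addrA addrNK.
Qed.

(** Induction on the nodes: [polar_sum_cons] is the recursion of [nsum], and
    the expansion around a new node only needs the nodes already treated. *)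
Theorem partial_fractions ns : uniq ns -> pf_valid ns.
Proof.
elim: ns => [|a ns IH] /=.
  move=> _ c F [|p k] g _ _ /=; first by rewrite shifted_nsum0 expr0.
  by rewrite big_ord0 shifted_nsum_nil // mulr0.
case/andP=> ans uns c F [|p k] g nc /=; first by rewrite shifted_nsum0 expr0.
case/andP=> p0 ik; rewrite -/(polar_sum _ (a :: ns) (p :: k)).
have ac : a != c by apply: nc; rewrite mem_head.
have nc' : {in ns, forall n, n != c} by move=> n nns; apply: nc; rewrite inE nns orbT.
rewrite polar_sum_cons //; last exact: IH.
rewrite -(IH uns c F (p :: k)) //=; last by rewrite p0.
rewrite /shifted_nsum /= mulrDr fpsDE; congr (_ + _).
rewrite mulrA (IH uns) //; apply: eq_polar_sum.
  by rewrite absorb0 // expr0 mulr1.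
move=> n nns e; rewrite absorb_mul ?(nc' n) //.
by apply: contraNneq ans => <-.
Qed.

(** The coefficient of s^m in F(s) / (s + n)^e; for n = 0 this is a Laurent
    series. *)
Definition laurent_coef F m n e : K :=
  if n == 0 then F (m + e)%N else (F * yinv n ^+ e) m.

Lemma laurent_coef0 F m n : laurent_coef F m n 0 = F m.
Proof. by rewrite /laurent_coef addn0 expr0 mulr1; case: ifP. Qed.

(** When n = 0 the second pole is the shift of coefficients by e. *)
Lemma absorb_laurent F m a p n e : n != a -> a != 0 -> (0 < p)%N ->
  absorb (laurent_coef F m) a p n e = laurent_coef (F * yinv a ^+ p) m n e.
Proof.
move=> na a0 p0; have [->|n0] := eqVneq n 0; last first.
  transitivity (absorb (fun n e => (F * yinv (n - 0) ^+ e) m) a p n e).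
    rewrite /absorb /laurent_coef (negbTE n0) (negbTE a0).
    by congr (_ + _); apply: eq_bigr => h _; rewrite subr0.
  by rewrite absorb_mul // /laurent_coef (negbTE n0) !subr0.
rewrite /absorb /laurent_coef (negbTE a0) eqxx.
have a0' : - a != 0 by rewrite oppr_eq0.
rewrite (@two_pole (fun p e => (F * yinv a ^+ p) (m + e)%N) (- a) a0')
  ?addn_gt0 ?p0 //.
  rewrite sub0r subr0 opprK; congr (_ + _); apply: eq_bigr => h _.
    by rewrite addn0.
  by rewrite expr0 mulr1.
by move=> {p p0}p q; rewrite mulNr yinvXS // addnS opprB.
Qed.

Lemma absorb_laurent0 F m p n e : n != 0 -> (0 < p)%N ->
  absorb (laurent_coef F m) 0 p n e = (F * yinv n ^+ e) (m + p)%N.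
Proof.
move=> n0 p0; rewrite /absorb /laurent_coef eqxx (negbTE n0).
rewrite (@two_pole (fun p e => (F * yinv n ^+ e) (m + p)%N) n n0) ?addn_gt0 ?p0 //.
  rewrite subr0 sub0r; congr (_ + _); apply: eq_bigr => h _.
    by rewrite expr0 mulr1.
  by rewrite addn0.
by move=> {p p0}p q; rewrite yinvXS // addnS.
Qed.

(** The expansion in s of the regular part at 0, when 0 is one of the nodes.
    Nodes on the left of 0 multiply F; at 0 itself the coefficients are
    shifted, after which the remaining nodes are covered by
    [partial_fractions]. *)
Theorem partial_fractions_at_pole neg pos F m k :
    uniq (neg ++ 0 :: pos) -> is_index k ->
  polar_sum (laurent_coef F m) (neg ++ 0 :: pos) k =
  (F * nsum (map yinv (neg ++ pos)) k) m
  + \sum_(j < size k)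
      (F * (nsum (map yinv neg) (take j k) * nsum (map yinv pos) (drop j.+1 k)))
        (m + nth 0%N k j)%N.
Proof.
have sh0 l : [seq yinv (n - 0) | n <- l] = map yinv l.
  by apply: eq_map => n; rewrite subr0.
elim: neg F k => [|a neg IH] F [|p k].
- by rewrite /= laurent_coef0 big_ord0 addr0 nsum_nil mulr1.
- rewrite [_ ++ _]/= => /andP[n0 up] /andP[p0 ik].
  have pn0 : {in pos, forall n, n != 0} by move=> n npos; apply: contraNneq n0 => <-.
  have pf := partial_fractions up.
  rewrite polar_sum_cons //; congr (_ + _).
    rewrite /= -sh0 [RHS](pf 0) //=; last by rewrite p0.
    rewrite -/(polar_sum _ pos (p :: k)).
    apply: eq_polar_sum => [|n npos e]; first by rewrite laurent_coef0 expr0 mulr1.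
    by rewrite /laurent_coef (negbTE (pn0 _ npos)) subr0.
  rewrite big_ord_recl /= drop0 mul1r big1 ?addr0; last first.
    by move=> i _; rewrite mul0r mulr0 fps0E.
  rewrite -sh0 [RHS](pf 0) //.
  apply: eq_polar_sum => [|n npos e].
    by rewrite absorb0 // expr0 mulr1 /laurent_coef eqxx.
  by rewrite absorb_laurent0 ?pn0 // subr0.
- move=> _ _; rewrite nsum_nil /= laurent_coef0 big_ord0 addr0.
  exact/esym/(congr1 (fun f : fps K => f m))/mulr1.
rewrite cat_cons => /= /andP[an un] /andP[p0 ik].
rewrite -/(polar_sum _ (a :: (neg ++ 0 :: pos)) (p :: k)).
have a0 : a != 0 by apply: contraNneq an => ->; rewrite mem_cat mem_head orbT.
rewrite polar_sum_cons //; last exact: partial_fractions.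
rewrite IH //=; last by rewrite p0.
rewrite (_ : polar_sum (absorb _ _ _) _ _ =
   polar_sum (laurent_coef (F * yinv a ^+ p) m) (neg ++ 0 :: pos) k); last first.
  apply: eq_polar_sum => [|n nn e].
    by rewrite absorb0 // laurent_coef0 /laurent_coef (negbTE a0).
  by apply: absorb_laurent => //; apply: contraNneq an => <-.
rewrite IH // mulrDr fpsDE mulrA -!addrA; congr (_ + _).
rewrite addrCA; congr (_ + _).
rewrite !big_ord_recl /= !nsum_nil addr0 -addrA; congr (_ + _).
rewrite -big_split; apply: eq_bigr => j _ /=.
rewrite -fpsDE; apply: (congr1 (fun f : fps K => f _)); ring.
Qed.

End PartialFractions.

(** * Symmetric windows of integers *)

Section Windows.
Variable K : numFieldType.
Implicit Types (p q Q : nat) (k : seq nat) (t : K).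

Definition pos_nodes q : seq K := [seq i.+1%:R | i <- iota 0 q].
Definition neg_nodes p : seq K := rev (map -%R (pos_nodes p)).
Definition window Q : seq K := neg_nodes Q ++ 0 :: pos_nodes Q.

Lemma size_pos_nodes q : size (pos_nodes q) = q.
Proof. by rewrite size_map size_iota. Qed.

Lemma size_neg_nodes q : size (neg_nodes q) = q.
Proof. by rewrite size_rev size_map size_pos_nodes. Qed.

Lemma size_window Q : size (window Q) = (Q + Q).+1.
Proof. by rewrite size_cat /= size_neg_nodes size_pos_nodes addnS. Qed.

Lemma nth_pos_nodes q i : (i < q)%N -> (pos_nodes q)`_i = i.+1%:R.
Proof. by move=> iq; rewrite (nth_map 0%N) ?size_iota // nth_iota. Qed.

Lemma nth_neg_nodes p i : (i < p)%N -> (neg_nodes p)`_i = i%:R - p%:R.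
Proof.
move=> ip; rewrite nth_rev size_map size_pos_nodes // (nth_map 0) ?size_pos_nodes; last by lia.
by rewrite nth_pos_nodes ?subnSK //; [rewrite natrB ?opprB // ltnW | lia].
Qed.

Lemma nth_window Q i : (i < (Q + Q).+1)%N -> (window Q)`_i = i%:R - Q%:R.
Proof.
move=> iQ; rewrite nth_cat size_neg_nodes; case: ltnP => [|Qi]; first exact: nth_neg_nodes.
rewrite -[in RHS](subnKC Qi) natrD addrAC subrr add0r.
case jE: (i - Q)%N => [|j] //=.
by rewrite nth_pos_nodes //; lia.
Qed.

Lemma uniq_window Q : uniq (window Q).
Proof.
apply/(uniqP 0) => i j; rewrite !inE size_window => iQ jQ.
by rewrite !nth_window // => /addIr /eqP; rewrite eqr_nat => /eqP.
Qed.

Lemma window_left Q i : (i < (Q + Q).+1)%N ->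
  [seq n - (window Q)`_i | n <- take i (window Q)] = neg_nodes i.
Proof.
move=> iQ; have st : size (take i (window Q)) = i by rewrite size_take size_window iQ.
apply: (@eq_from_nth _ 0); rewrite size_map st ?size_neg_nodes // => j ji.
rewrite (nth_map 0) ?st // nth_take // nth_neg_nodes // !nth_window //; first by ring.
exact: ltn_trans iQ.
Qed.

Lemma window_right Q i : (i < (Q + Q).+1)%N ->
  [seq n - (window Q)`_i | n <- drop i.+1 (window Q)] = pos_nodes (Q + Q - i).
Proof.
move=> iQ; have sd : size (drop i.+1 (window Q)) = (Q + Q - i)%N.
  by rewrite size_drop size_window subSS.
apply: (@eq_from_nth _ 0); rewrite size_map sd ?size_pos_nodes // => j ji.
rewrite (nth_map 0) ?sd // nth_drop nth_pos_nodes // !nth_window //; last by lia.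
by rewrite natrD -[j.+1]addn1 -[i.+1]addn1 !natrD; ring.
Qed.

(** Truncated nested Hurwitz series: sum of prod_i 1/(s + n_i)^(k_i) over
    0 < n_1 < ... < n_r <= q. *)
Definition hurwitz q k : fps K := nsum (map (@yinv K) (pos_nodes q)) k.

Definition harm q k : K := nsum [seq n^-1 | n <- pos_nodes q] k.

(** The substitution n -> -n reverses the order of the summation variables. *)
Lemma hurwitz_neg p k :
  nsum (map (@yinv K) (neg_nodes p)) k =
  (-1) ^+ sumn k * fps_flip (hurwitz p (rev k)).
Proof.
rewrite -nsum_rev map_rev revK /hurwitz nsum_rmorph -(sumn_rev k) -nsum_opp.
congr nsum; rewrite -!map_comp; apply: eq_map => n /=; apply/funext => i.
rewrite fpsNE /fps_flip /yinv invrN (exprNn n.+1%:R^-1) (exprS (-1)); by rewrite mulN1r mulNr mulrN.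
Qed.

(** The coefficient at h of the expansion around node 0 of the contributions
    where the j-th entry of k sits at 0, the nodes being -p, ..., q. *)
Definition cut p q k j : fps K :=
  nsum (map (@yinv K) (neg_nodes p)) (take j k) * hurwitz q (drop j.+1 k).

(** Seen from its i-th node, the window from -Q to Q becomes the window from
    -i to 2Q - i. *)
Definition window_polar (xi : K -> nat -> K) Q k : K :=
  \sum_(i < (Q + Q).+1) \sum_(j < size k) \sum_(h < nth 0%N k j)
     cut i (Q + Q - i) k j h * xi (i%:R - Q%:R) (nth 0%N k j - h)%N.

Lemma polar_sum_window xi Q k : k != [::] ->
  polar_sum xi (window Q) k = window_polar xi Q k.
Proof.
case: k => // a k _; rewrite /polar_sum size_window; apply: eq_bigr => i _.
apply: eq_bigr => j _; apply: eq_bigr => h _.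
rewrite -nth_window //; congr (_ * _).
rewrite /cut /hurwitz -(window_left (ltn_ord i)) -(window_right (ltn_ord i)).
by rewrite -!map_comp.
Qed.

Lemma window_identity Q k m : k != [::] -> is_index k ->
  window_polar (laurent_coef 1 m) Q k =
  nsum (map (@yinv K) (neg_nodes Q ++ pos_nodes Q)) k m
  + \sum_(j < size k) cut Q Q k j (m + nth 0%N k j)%N.
Proof.
move=> k0 ik; rewrite -polar_sum_window // (partial_fractions_at_pole _ _ (uniq_window Q)) //.
by rewrite mul1r; congr (_ + _); apply: eq_bigr => j _; rewrite mul1r.
Qed.

Lemma window_identity_at Q k t : k != [::] -> is_index k ->
    {in window Q, forall n, n + t != 0} ->
  window_polar (fun n e => (n + t)^-1 ^+ e) Q k =
  nsum [seq (n + t)^-1 | n <- window Q] k.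
Proof.
move=> k0 ik nt; rewrite -polar_sum_window //.
have cst n e : (yinv n ^+ e : fps K) 0%N = n^-1 ^+ e.
  rewrite -[LHS]/(fps_const_coef _) rmorphXn; congr (_ ^+ _).
  by rewrite -[LHS]/((-1) ^+ 0 * n^-1 ^+ 1) expr0 mul1r.
have /(_ (- t) 1 k 0%N) := partial_fractions (uniq_window Q).
rewrite mul1r => /(_ _ ik) E.
transitivity (fps_const_coef (shifted_nsum (window Q) (- t) k)).
  rewrite [RHS]E; last by move=> n /nt; rewrite addr_eq0.
  by apply: eq_polar_sum => [|n _ e]; rewrite /= ?mul1r ?cst ?opprK.
rewrite /shifted_nsum nsum_rmorph -map_comp; congr nsum; apply: eq_map => n /=.
by rewrite opprK -[RHS]expr1 -cst expr1.
Qed.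

End Windows.

(** * Expansion in the shift *)

Section Shifts.
Variable K : fieldType.
Implicit Types (Z : seq nat -> K) (k : seq nat).

(** The passage from zeta_star to zeta_(star,m), for an arbitrary function on
    indices. *)
Definition shift_coef Z m k : K :=
  \sum_(lam : {ffun 'I_(size k) -> 'I_m.+1} | (\sum_i (lam i : nat))%N == m)
     (\prod_(i < size k) gbinom (- (nth 0%N k i)%:R) (lam i))
     * Z [seq (nth 0%N k i + lam i)%N | i : 'I_(size k)].

(** Only the tuples of sum m matter, so the bound on the entries is free. *)
Definition shift_coef_le N Z m k : K :=
  \sum_(lam : {ffun 'I_(size k) -> 'I_N.+1} | (\sum_i (lam i : nat))%N == m)
     (\prod_(i < size k) gbinom (- (nth 0%N k i)%:R) (lam i))
     * Z [seq (nth 0%N k i + lam i)%N | i : 'I_(size k)].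

Fixpoint shift_rec Z m k : K :=
  if k is a :: k' then
    \sum_(l < m.+1) gbinom (- a%:R) l * shift_rec (fun w => Z ((a + l)%N :: w)) (m - l)%N k'
  else (m == 0%N)%:R * Z [::].

Definition ffun_cons (n : nat) (T : Type) (p : T * {ffun 'I_n -> T}) : {ffun 'I_n.+1 -> T} :=
  [ffun i => if unlift ord0 i is Some j then p.2 j else p.1].

Lemma ffun_cons_bij n T : bijective (@ffun_cons n T).
Proof.
exists (fun f : {ffun 'I_n.+1 -> T} => (f ord0, [ffun j => f (fintype.lift ord0 j)])).
  move=> [x f]; rewrite /ffun_cons; congr (_, _).
    by rewrite ffunE unlift_none.
  by apply/ffunP => j; rewrite !ffunE liftK.
move=> f; apply/ffunP => i; rewrite ffunE; case: unliftP => [j ->|->] //=.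
by rewrite ffunE.
Qed.

Lemma ffun_cons0 n T p : @ffun_cons n T p ord0 = p.1.
Proof. by rewrite ffunE unlift_none. Qed.
Lemma ffun_consS n T p j : @ffun_cons n T p (fintype.lift ord0 j) = p.2 j.
Proof. by rewrite ffunE liftK. Qed.

Lemma shift_coef_leE N Z m k : (m <= N)%N -> shift_coef_le N Z m k = shift_rec Z m k.
Proof.
elim: k Z m => [|a k IH] Z m mN.
  rewrite /shift_coef_le /= (eq_bigl (fun=> m == 0%N)); last first.
    by move=> f; rewrite big_ord0 eq_sym.
  have enum0 : enum 'I_0 = [::] by apply: size0nil; rewrite size_enum_ord.
  case: (m == 0%N); last by rewrite big_pred0_eq mul0r.
  rewrite mul1r (eq_bigr (fun=> Z [::])); last first.
    by move=> f _; rewrite big_ord0 mul1r /image_mem enum0.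
  by rewrite sumr_const card_ffun !card_ord expn0.
rewrite /shift_coef_le /= (reindex _ (onW_bij _ (@ffun_cons_bij _ _))) /=.
rewrite (eq_bigl (fun p : 'I_N.+1 * {ffun 'I_(size k) -> 'I_N.+1} =>
   true && ((p.1 <= m)%N && ((\sum_i p.2 i)%N == m - p.1)%N))); last first.
  move=> p; rewrite big_ord_recl ffun_cons0.
  rewrite (eq_bigr (fun i => (p.2 i : nat))); last by move=> i _; rewrite ffun_consS.
  rewrite andTb; by apply/eqP/andP => [<-|[pm /eqP ->]]; [rewrite leq_addr addKn | rewrite subnKC].
rewrite -(pair_big_dep xpredT (fun (l : 'I_N.+1) (f : {ffun 'I_(size k) -> 'I_N.+1}) =>
   (l <= m)%N && ((\sum_i f i)%N == m - l)%N)
   (fun l f => (\prod_(i < (size k).+1)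
      gbinom (- (nth 0%N (a :: k) i)%:R) (ffun_cons (l, f) i)) *
   Z [seq (nth 0%N (a :: k) i + ffun_cons (l, f) i)%N | i : 'I_(size k).+1])) /=.
rewrite (big_ord_widen_cond _ xpredT (fun l => gbinom (- a%:R) l *
   shift_rec (fun w => Z ((a + l)%N :: w)) (m - l)%N k) (_ : m.+1 <= N.+1)%N) //.
rewrite [RHS]big_mkcond /=; apply: eq_bigr => l _; rewrite ltnS.
case: leqP => lm; last by rewrite big_pred0_eq.
rewrite -IH ?(leq_trans (leq_subr _ _)) // mulr_sumr; apply: eq_bigr => f _.
rewrite mulrA big_ord_recl ffun_cons0 /=; congr (_ * _ * _).
  by apply: eq_bigr => i _; rewrite ffun_consS.
congr Z; rewrite /image_mem enum_ordSl /= ffun_cons0; congr (_ :: _).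
by rewrite -map_comp; apply: eq_map => i; rewrite /= ffun_consS.
Qed.

Lemma shift_coefE Z m k : shift_coef Z m k = shift_rec Z m k.
Proof. exact: shift_coef_leE. Qed.

Lemma shift_rec0 m k : shift_rec (fun=> 0) m k = 0.
Proof.
elim: k m => [|b k IH] m /=; first by rewrite mulr0.
by rewrite big1 // => i _; rewrite IH mulr0.
Qed.

Lemma shift_recD Z1 Z2 m k :
  shift_rec (fun w => Z1 w + Z2 w) m k = shift_rec Z1 m k + shift_rec Z2 m k.
Proof.
elim: k m Z1 Z2 => [|a k IH] m Z1 Z2 /=; first by rewrite mulrDr.
by rewrite -big_split; apply: eq_bigr => l _ /=; rewrite IH mulrDr.
Qed.

Lemma shift_recZ c Z m k : shift_rec (fun w => c * Z w) m k = c * shift_rec Z m k.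
Proof.
elim: k m Z => [|a k IH] m Z /=; first by rewrite mulrCA.
by rewrite mulr_sumr; apply: eq_bigr => l _; rewrite IH mulrCA.
Qed.

End Shifts.

Section HurwitzCoefficients.
Variable K : numFieldType.

Lemma gbinomN_rec (a l : nat) :
  gbinom (- a.+1%:R : K) l.+1 = gbinom (- a%:R) l.+1 - gbinom (- a.+1%:R) l.
Proof.
rewrite /gbinom big_ord_recr [in X in _ = X - _]big_ord_recl /= subr0.
have -> : \prod_(i < l) (- a%:R - (bump 0 i)%:R) = \prod_(i < l) (- a.+1%:R - i%:R) :> K.
  apply: eq_bigr => i _; rewrite /bump /= add1n -(addn1 a) -(addn1 i) !natrD.
  by rewrite !opprD addrA addrAC.
set P := \prod_(i < l) _; rewrite factS natrM invfM.
have f0 : (l`!%:R : K) != 0 by rewrite pnatr_eq0 -lt0n fact_gt0.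
have l0 : (l.+1%:R : K) != 0 by rewrite pnatr_eq0.
rewrite -!(addn1 a) -(addn1 l) !natrD in l0 *; field; exact/andP.
Qed.

(** Both sides satisfy the recursion of [yinvXS], by Pascal's rule. *)
Lemma yinv_exp_coef (n : K) a l : n != 0 ->
  (yinv n ^+ a : fps K) l = gbinom (- a%:R) l * n^-1 ^+ (a + l).
Proof.
move=> n0; elim: a l => [|a IHa] l.
  rewrite expr0 fps1E; case: l => [|l].
    by rewrite /gbinom big_ord0 mul1r invr1 !mul1r.
  by rewrite /gbinom oppr0 big_ord_recl subr0 !mul0r.
elim: l => [|l IHl].
  have := yinvXS 1 a 0 n0; rewrite !mul1r subr0 IHa => E.
  apply: (mulfI n0); rewrite E !addn0 /gbinom !big_ord0 invr1 !mul1r.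
  by rewrite exprS mulVKf.
have := yinvXS 1 a l.+1 n0; rewrite !mul1r IHa IHl => E.
apply: (mulfI n0); rewrite E gbinomN_rec mulrBl mulrBr addSn (exprS _ (a + l.+1)).
rewrite [n * (_ * _)]mulrCA mulVKf //; congr (_ - _).
by rewrite mulrCA mulVKf // addnS.
Qed.

(** Binomial expansion of each factor 1/(s + n)^a. *)
Lemma hurwitz_coef q m k : hurwitz K q k m = shift_rec (harm K q) m k.
Proof.
rewrite /hurwitz /harm.
have : all (fun n : K => n != 0) (pos_nodes K q).
  by apply/allP => n /mapP[i _ ->]; rewrite pnatr_eq0.
elim: (pos_nodes K q) m k => [|n ns IH] m k /=.
  move=> _; elim: k m => [|a k IHk] m /=.
    by rewrite mulr1.
  by rewrite [RHS]big1 // => l _; rewrite shift_rec0 ?mulr0.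
case/andP=> n0 ns0; case: k => [|a k] /=.
  by rewrite !nsum_nil !addr0 mulr1.
rewrite fpsDE IH //= fpsME -big_split /=; apply: eq_bigr => l _.
rewrite shift_recD mulrDr; congr (_ + _).
by rewrite shift_recZ -IH // yinv_exp_coef // mulrA.
Qed.

End HurwitzCoefficients.

(** * The stuffle product *)

Section Spans.
Implicit Types (u v w : seq nat) (x y z : index_span).

HB.instance Definition _ (M : lmodType rat) (f : seq nat -> M) :=
  GRing.isAdditive.Build index_span M (fglift f) (lift_is_additive f).

Lemma fgliftE (M : lmodType rat) (f : seq nat -> M) x :
  fglift f x = \sum_(w <- dom x) coeff w x *: f w.
Proof.
rewrite -[in LHS](freeg_sumE x) raddf_sum; apply: eq_bigr => w _.
exact: liftU.
Qed.

Lemma fglift1 (M : lmodType rat) (f : seq nat -> M) w : fglift f << w >> = f w.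
Proof. by rewrite liftU scale1r. Qed.

Lemma fgliftZ (M : lmodType rat) (f : seq nat -> M) c x :
  fglift f (c *: x) = c *: fglift f x.
Proof.
rewrite -[in LHS](freeg_sumE x) [in RHS]fgliftE !scaler_sumr raddf_sum; apply: eq_bigr => w _ /=.
have -> : c *: << coeff w x *g w >> = << (c * coeff w x) *g w >> :> index_span.
  by apply/eqP/freeg_eqP => v; rewrite coeffZ !coeffU mulrA.
by rewrite liftU scalerA.
Qed.

Lemma freeg_scaleE x : x = \sum_(w <- dom x) coeff w x *: << w >>.
Proof.
rewrite -[LHS]freeg_sumE; apply: eq_bigr => w _.
by apply/eqP/freeg_eqP => v; rewrite coeffZ !coeffU mul1r.
Qed.

Definition in_span (P : seq nat -> Prop) x := forall w, w \in dom x -> P w.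

Lemma in_spanW (P P' : seq nat -> Prop) x :
  (forall w, P w -> P' w) -> in_span P x -> in_span P' x.
Proof. by move=> PP' Px w /Px /PP'. Qed.

Lemma in_span1 (P : seq nat -> Prop) w : P w -> in_span P << w >>.
Proof. by move=> Pw v; rewrite domU1 inE => /eqP ->. Qed.

Lemma in_span0 P : in_span P 0.
Proof. by move=> w; rewrite dom0. Qed.

Lemma in_spanD P x y : in_span P x -> in_span P y -> in_span P (x + y).
Proof. by move=> Px Py w /domD_subset; rewrite mem_cat => /orP[/Px|/Py]. Qed.

Lemma in_spanZ P c x : in_span P x -> in_span P (c *: x).
Proof. by move=> Px w /domZ_subset /Px. Qed.

Lemma in_span_ind (P : seq nat -> Prop) (X : index_span -> Prop) :
    X 0 -> (forall x y, X x -> X y -> X (x + y)) ->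
    (forall c w, P w -> X (c *: << w >>)) -> forall x, in_span P x -> X x.
Proof.
move=> X0 XD XU x Px; rewrite (freeg_scaleE x) big_seq.
by elim/big_ind: _ => // w /Px; apply: XU.
Qed.

Lemma prepend1 a w : prepend a << w >> = << a :: w >>.
Proof. exact: fglift1. Qed.

Lemma prependD a x y : prepend a (x + y) = prepend a x + prepend a y.
Proof. exact: raddfD. Qed.

Lemma prependZ a c x : prepend a (c *: x) = c *: prepend a x.
Proof. exact: fgliftZ. Qed.

Lemma in_span_prepend (P P' : seq nat -> Prop) a x :
  (forall w, P w -> P' (a :: w)) -> in_span P x -> in_span P' (prepend a x).
Proof.
move=> PP'; apply: (@in_span_ind P (fun x => in_span P' (prepend a x))).
- by rewrite /prepend raddf0; apply: in_span0.
- by move=> y z Py Pz; rewrite prependD; apply: in_spanD.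
- by move=> c w Pw; rewrite prependZ prepend1; apply: in_spanZ; apply: in_span1; apply: PP'.
Qed.

Lemma stuffle_basis_cons a u b v :
  stuffle_basis (a :: u) (b :: v) =
  prepend a (stuffle_basis u (b :: v)) + prepend b (stuffle_basis (a :: u) v)
  + prepend (a + b) (stuffle_basis u v).
Proof. by []. Qed.

Lemma stuffle_basis0l v : stuffle_basis [::] v = << v >>.
Proof. by case: v. Qed.

Lemma stuffle_basis0r u : stuffle_basis u [::] = << u >>.
Proof. by case: u. Qed.

Lemma stuffle1 u v : stuffle << u >> << v >> = stuffle_basis u v.
Proof. by rewrite /stuffle !fglift1. Qed.

Lemma stuffleDr x y z : stuffle x (y + z) = stuffle x y + stuffle x z.
Proof.
rewrite /stuffle !fgliftE -big_split; apply: eq_bigr => w _ /=.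
by rewrite raddfD scalerDr.
Qed.

Lemma stuffle0r x : stuffle x 0 = 0.
Proof. by rewrite /stuffle fgliftE big1 // => w _; rewrite raddf0 scaler0. Qed.

Lemma stuffleZr x c y : stuffle x (c *: y) = c *: stuffle x y.
Proof.
rewrite /stuffle !fgliftE scaler_sumr; apply: eq_bigr => w _.
by rewrite fgliftZ !scalerA mulrC.
Qed.

Lemma stuffleDl x y z : stuffle (x + y) z = stuffle x z + stuffle y z.
Proof. exact: raddfD. Qed.

Lemma stuffle0l z : stuffle 0 z = 0.
Proof. exact: raddf0. Qed.

Lemma stuffleZl c x z : stuffle (c *: x) z = c *: stuffle x z.
Proof. exact: fgliftZ. Qed.

Lemma stuffle_nill x : stuffle << [::] >> x = x.
Proof.
rewrite /stuffle fglift1 fgliftE [RHS]freeg_scaleE; apply: eq_bigr => w _.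
by rewrite stuffle_basis0l.
Qed.

Lemma stuffle_nilr x : stuffle x << [::] >> = x.
Proof.
rewrite /stuffle fgliftE [RHS]freeg_scaleE; apply: eq_bigr => w _.
by rewrite fglift1 stuffle_basis0r.
Qed.

Let anyw (w : seq nat) := True.
Let span_ind (X : index_span -> Prop) (X0 : X 0)
  (XD : forall x y, X x -> X y -> X (x + y))
  (XU : forall c w, X (c *: << w >>)) x : X x.
Proof. by apply: (@in_span_ind anyw X) => // c w _. Qed.

Notation mulone := (stuffle << [:: 1%N] >>).

(** The factor 1 comes first, or it is merged into b, or it goes further. *)
Lemma mulone_prepend b z :
  mulone (prepend b z) = prepend 1 (prepend b z) + prepend b (mulone z) + prepend (1 + b) z.
Proof.
elim/span_ind: z.
- by rewrite /prepend !raddf0 stuffle0r raddf0 !addr0.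
- move=> x y IHx IHy; rewrite !(prependD, stuffleDr) IHx IHy.
  by rewrite addrACA; congr (_ + _); rewrite addrACA.
- move=> c w; rewrite !(prependZ, stuffleZr) !prepend1 -!scalerDr; congr (_ *: _).
  by rewrite !stuffle1 stuffle_basis_cons !stuffle_basis0l !prepend1.
Qed.

Lemma stuffle_prepend a u b z :
  stuffle << a :: u >> (prepend b z) =
  prepend a (stuffle << u >> (prepend b z)) + prepend b (stuffle << a :: u >> z)
  + prepend (a + b) (stuffle << u >> z).
Proof.
elim/span_ind: z.
- by rewrite /prepend !raddf0 !stuffle0r !raddf0 !addr0.
- move=> x y IHx IHy; rewrite !(prependD, stuffleDr) IHx IHy.
  by rewrite addrACA; congr (_ + _); rewrite addrACA.
- move=> c w; rewrite !(prependZ, stuffleZr) !prepend1 -!scalerDr; congr (_ *: _).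
  by rewrite !stuffle1 stuffle_basis_cons.
Qed.

(** Multiplication by the index (1) commutes with the product: the only
    instance of commutativity and associativity needed to form the powers of
    (1). *)
Lemma mulone_stuffle_basis u v :
  mulone (stuffle_basis u v) = stuffle << u >> (mulone << v >>).
Proof.
elim: u v => [|a u IHu] v; first by rewrite stuffle_basis0l stuffle_nill.
elim: v => [|b v IHv].
  have := IHu [::]; rewrite !stuffle_basis0r !stuffle_nilr => IH.
  rewrite -[in LHS](prepend1 a u) mulone_prepend IH.
  rewrite -[in RHS](prepend1 1 [::]) stuffle_prepend !stuffle_nilr !prepend1.
  by rewrite addnC [<< _ >> + prepend _ _]addrC.
rewrite stuffle_basis_cons !stuffleDr !mulone_prepend !IHu IHv.
have Dbv : mulone << b :: v >> =
    prepend 1 << b :: v >> + prepend b (mulone << v >>) + prepend (1 + b) << v >>.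
  by rewrite -[in LHS](prepend1 b v) mulone_prepend prepend1.
rewrite !Dbv !stuffleDr !stuffle_prepend !stuffle1 stuffle_basis_cons !prependD.
rewrite (addnC a 1%N) (addnCA a 1%N b) !addrA.
by rewrite [LHS](ACl (2*1*6*9*5*3*7*10*4*8*11))%AC.
Qed.

Lemma mulone_stuffle x y : mulone (stuffle x y) = stuffle x (mulone y).
Proof.
elim/span_ind: x.
- by rewrite !stuffle0l stuffle0r.
- by move=> x z IHx IHz; rewrite !stuffleDl stuffleDr IHx IHz.
move=> c u; rewrite !stuffleZl stuffleZr; congr (_ *: _).
elim/span_ind: y.
- by rewrite !stuffle0r.
- by move=> x z IHx IHz; rewrite !stuffleDr IHx IHz.
by move=> d v; rewrite !stuffleZr stuffle1 mulone_stuffle_basis.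
Qed.

(** Polynomials of degree at most [n] in (1), with admissible coefficients. *)
Definition decomposable n x := exists u : nat -> index_span,
  (forall l, in_span admissible (u l)) /\
  x = \sum_(l < n.+1) stuffle (u l) (stuffle_exp << [:: 1%N] >> l).

Lemma decomposable0 n : decomposable n 0.
Proof.
exists (fun=> 0); split=> [l|]; first exact: in_span0.
by rewrite big1 // => l _; rewrite stuffle0l.
Qed.

Lemma decomposableD n x y : decomposable n x -> decomposable n y -> decomposable n (x + y).
Proof.
move=> [u [au ->]] [v [av ->]]; exists (fun l => u l + v l).
split=> [l|]; first exact: in_spanD.
by rewrite -big_split; apply: eq_bigr => l _; rewrite stuffleDl.
Qed.

Lemma decomposableZ n c x : decomposable n x -> decomposable n (c *: x).
Proof.
move=> [u [au ->]]; exists (fun l => c *: u l).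
split=> [l|]; first exact: in_spanZ.
by rewrite scaler_sumr; apply: eq_bigr => l _; rewrite stuffleZl.
Qed.

Lemma decomposableW m n x : (m <= n)%N -> decomposable m x -> decomposable n x.
Proof.
move=> mn [u [au ->]]; exists (fun l => if (l < m.+1)%N then u l else 0).
split=> [l|]; first by case: ifP => // _; apply: in_span0.
rewrite (big_ord_widen n.+1 (fun l => stuffle (u l) (stuffle_exp << [:: 1%N] >> l))) //.
rewrite big_mkcond; apply: eq_bigr => l _; by case: ifP => // _; rewrite stuffle0l.
Qed.

Lemma decomposable_mulone n x : decomposable n x -> decomposable n.+1 (mulone x).
Proof.
move=> [u [au ->]]; exists (fun l => if l is l'.+1 then u l' else 0).
split=> [[|l]|]; [exact: in_span0|exact: au|].
rewrite [RHS]big_ord_recl stuffle0l add0r.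
elim/big_rec2: _ => [|l x1 x2 _ <-]; first exact: stuffle0r.
by rewrite stuffleDr mulone_stuffle.
Qed.

Lemma decomposable_admissible w : admissible w -> decomposable 0 << w >>.
Proof.
move=> aw; exists (fun=> << w >>); split=> [l|]; first exact: in_span1.
by rewrite big_ord_recl big_ord0 addr0 stuffle_nilr.
Qed.

Lemma is_index_cat u v : is_index (u ++ v) = is_index u && is_index v.
Proof. exact: all_cat. Qed.

Lemma is_index_nseq1 n : is_index (nseq n 1%N).
Proof. by rewrite /is_index all_nseq orbT. Qed.

(** The factor 1 can be inserted at p + 1 places, or merged into one of the p
    entries. *)
Lemma mulone_ones p : exists2 y,
  in_span (fun w => [/\ is_index w, size w = p & has (leq 2) w]) y &
  mulone << nseq p 1%N >> = p.+1%:R *: << nseq p.+1 1%N >> + y.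
Proof.
elim: p => [|p [y yP IH]].
  exists 0; first exact: in_span0.
  by rewrite stuffle_nilr scale1r addr0.
exists (prepend 1 y + << 2%N :: nseq p 1%N >>).
  apply: in_spanD; last first.
    by apply: in_span1; rewrite /= size_nseq is_index_nseq1.
  by apply: in_span_prepend yP => w [/= -> ->].
rewrite -[in LHS](prepend1 1 (nseq p 1%N)) mulone_prepend IH prependD prependZ !prepend1.
rewrite -[in RHS]natr1 scalerDl scale1r !addrA.
by congr (_ + _ + _); rewrite addrC.
Qed.

(** Inserting 1 among the trailing ones gives the same index p + 1 times;
    inserting it earlier keeps the number of trailing ones and the
    admissibility of what precedes, and merging it lowers the depth. *)
Lemma mulone_admissible_ones v p : admissible v -> exists2 y,
  in_span (fun w => is_index w /\ ((exists2 v', w = v' ++ nseq p 1%N &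
      admissible v' /\ size v' = (size v).+1) \/ (size w <= size v + p)%N)) y &
  mulone << v ++ nseq p 1%N >> = p.+1%:R *: << v ++ nseq p.+1 1%N >> + y.
Proof.
elim: v => [|b v IH] av.
  have [y yP ->] := mulone_ones p; exists y => //.
  by apply: in_spanW yP => w [iw sw _]; split=> //; right; rewrite sw.
have [b0 iv] : (0 < b)%N /\ is_index v by move: av => /andP[/andP[]].
have [y yP E] : exists2 y,
   in_span (fun w => is_index (b :: w) /\ ((exists2 v', b :: w = v' ++ nseq p 1%N &
      admissible v' /\ size v' = (size v).+2) \/ (size w <= size v + p)%N)) y &
   mulone << v ++ nseq p 1%N >> = p.+1%:R *: << v ++ nseq p.+1 1%N >> + y.
  have [v0|v0] := eqVneq v [::].
    have [y yP E] := mulone_ones p; exists y; rewrite ?v0 //.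
    apply: in_spanW yP => w [iw sw _]; split; first by rewrite /= b0.
    by right; rewrite sw.
  have av' : admissible v.
    move: av; rewrite /admissible iv /= => /andP[_] lv.
    by rewrite (negbTE v0); case: v v0 lv {IH iv}.
  have [y yP E] := IH av'; exists y => //.
  apply: in_spanW yP => w [iw [[v' -> [av1 sv1]]|sw]]; split=> //=.
  - by rewrite b0 -/(is_index (v' ++ _)) is_index_cat is_index_nseq1 andbT; case/andP: av1.
  - left; exists (b :: v') => //; split; last by rewrite /= sv1.
    move: av1 sv1; rewrite /admissible /= b0; case: v' => //= c v' /andP[-> /=].
  - exact/andP.
  - by right.
exists (<< [:: 1%N, b & v] ++ nseq p 1%N >> + prepend b y + << (1 + b)%N :: v ++ nseq p 1%N >>).
  have ivp : is_index (v ++ nseq p 1%N) by rewrite is_index_cat iv is_index_nseq1.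
  apply: in_spanD; [apply: in_spanD|].
  - apply: in_span1; split; first by rewrite /= b0.
    left; exists [:: 1%N, b & v] => //; split=> //.
  - by apply: in_span_prepend yP => w [iw [H|H]]; split=> //; [left|right].
  - apply: in_span1; split; first exact: ivp.
    by right; rewrite /= size_cat size_nseq.
rewrite cat_cons -[in LHS](prepend1 b) mulone_prepend E prependD prependZ !prepend1.
by rewrite !addrA; congr (_ + _ + _); rewrite addrC.
Qed.

Lemma index_ones k : is_index k ->
  exists v p, admissible v /\ k = v ++ nseq p 1%N.
Proof.
elim/last_ind: k => [|k a IH]; first by exists [::], 0%N.
move=> ik; have [ika a0] : is_index k /\ (0 < a)%N.
  by move: ik; rewrite -cats1 is_index_cat => /andP[? /andP[]].
have [a1|a1] := eqVneq a 1%N.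
  have [v [p [av ->]]] := IH ika; exists v, p.+1; split=> //.
  by rewrite a1 rcons_cat; congr (_ ++ _); elim: (p) => //= q ->.
exists (rcons k a), 0%N; rewrite cats0; split=> //.
rewrite /admissible ik last_rcons; case: a a0 a1 {ik} => [|[|a]] // _ _.
by rewrite orbT.
Qed.

(** Induction on the depth, then on the number of trailing ones. *)
Lemma decomposable_index k : is_index k -> decomposable (size k) << k >>.
Proof.
have [n] := ubnP (size k); elim: n k => // n IHn k kn /index_ones [v [p [av kE]]].
move: kn; rewrite {}kE {k} size_cat size_nseq; elim: p v av => [|p IHp] v av vn.
  by rewrite cats0; apply: decomposableW (decomposable_admissible av).
have [y yP E] := mulone_admissible_ones p av.
(* Solve for the index with one more trailing 1. *)
have -> : << v ++ nseq p.+1 1%N >> = p.+1%:R^-1 *: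
    (mulone << v ++ nseq p 1%N >> + (-1) *: y) :> index_span.
  by rewrite E scaleN1r addrK scalerA mulVf ?pnatr_eq0 // scale1r.
apply/decomposableZ/decomposableD.
  rewrite addnS; apply: decomposable_mulone.
  rewrite -[X in (_ + X)%N](size_nseq p 1%N) -size_cat; apply: IHn.
    by rewrite size_cat size_nseq; move: vn; rewrite addnS ltnS.
  by rewrite is_index_cat is_index_nseq1 andbT; case/andP: av.
apply: decomposableZ; move: y yP {E}; apply: in_span_ind.
- exact: decomposable0.
- exact: decomposableD.
move=> c w [iw [[v' -> [av' sv']]|sw]]; apply: decomposableZ.
  have -> : (size v + p.+1 = size v' + p)%N by rewrite sv' addnS addSn.
  by apply: IHp => //; rewrite sv' addSn -addnS.
apply: (@decomposableW (size w)); first by rewrite addnS (leq_trans sw).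
by apply: IHn => //; apply: leq_ltn_trans sw _; move: vn; rewrite addnS ltnS.
Qed.

(** The chosen family is a decomposition as soon as one exists. *)
Lemma stuffle_decompositionP k : is_index k ->
  is_stuffle_decomposition (stuffle_decomposition k).
Proof.
move=> /decomposable_index [u [au E]]; apply: (@xgetPex _ _ (@is_stuffle_decomposition k)).
exists [ffun l : 'I_(size k).+1 => u l]; split=> [l|].
  by rewrite ffunE; apply/allP => w /au.
by rewrite E; apply: eq_bigr => l _; rewrite ffunE.
Qed.

End Spans.

(** * Linear evaluation *)

Section Evaluation.
Variable F : numFieldType.
Implicit Types (f : seq nat -> F) (x y : index_span).

Definition span_eval f x : F := \sum_(w <- dom x) ratr (coeff w x) * f w.

Lemma span_eval_sub f x s : uniq s -> {subset dom x <= s} ->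
  span_eval f x = \sum_(w <- s) ratr (coeff w x) * f w.
Proof.
move=> us sub; rewrite [RHS](bigID (mem (dom x))) /= [X in _ + X]big1 ?addr0.
  rewrite -big_filter; apply: perm_big; apply: uniq_perm; rewrite ?uniq_dom ?filter_uniq //.
  by move=> w; rewrite mem_filter; case: (boolP (w \in dom x)) => // /sub ->.
by move=> w wx; rewrite coeff_outdom // rmorph0 mul0r.
Qed.

Lemma span_evalD f x y : span_eval f (x + y) = span_eval f x + span_eval f y.
Proof.
have us : uniq (undup (dom x ++ dom y)) by apply: undup_uniq.
rewrite !(@span_eval_sub _ _ _ us).
- by rewrite -big_split; apply: eq_bigr => w _; rewrite coeffD rmorphD mulrDl.
- by move=> w wy; rewrite mem_undup mem_cat wy orbT.
- by move=> w wy; rewrite mem_undup mem_cat wy.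
- by move=> w wy; rewrite mem_undup; apply: domD_subset.
Qed.

Lemma span_eval0 f : span_eval f 0 = 0.
Proof. by rewrite /span_eval dom0 big_nil. Qed.

Lemma span_evalZ f c x : span_eval f (c *: x) = ratr c * span_eval f x.
Proof.
rewrite (@span_eval_sub _ _ (dom x)) ?uniq_dom //; last exact: domZ_subset.
by rewrite mulr_sumr; apply: eq_bigr => w _; rewrite coeffZ rmorphM mulrA.
Qed.

Lemma span_eval1 f w : span_eval f << w >> = f w.
Proof. by rewrite /span_eval domU1 big_seq1 coeffU eqxx mulr1 rmorph1 mul1r. Qed.

Lemma span_eval_sum f I (r : seq I) (P : pred I) (x : I -> index_span) :
  span_eval f (\sum_(i <- r | P i) x i) = \sum_(i <- r | P i) span_eval f (x i).
Proof. by apply: (big_morph (span_eval f)); [exact: span_evalD|exact: span_eval0]. Qed.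

Lemma span_eval_fglift f (g : seq nat -> index_span) x :
  span_eval f (fglift g x) = span_eval (fun w => span_eval f (g w)) x.
Proof. by rewrite fgliftE span_eval_sum; apply: eq_bigr => w _; rewrite span_evalZ. Qed.

Lemma span_evalMr f (c : F) x : span_eval (fun w => f w * c) x = span_eval f x * c.
Proof. by rewrite /span_eval mulr_suml; apply: eq_bigr => w _; rewrite mulrA. Qed.

Lemma span_evalMl f (c : F) x : span_eval (fun w => c * f w) x = c * span_eval f x.
Proof. by rewrite /span_eval mulr_sumr; apply: eq_bigr => w _; rewrite mulrCA. Qed.

Lemma span_eval_addf f g x :
  span_eval (fun w => f w + g w) x = span_eval f x + span_eval g x.
Proof. by rewrite /span_eval -big_split; apply: eq_bigr => w _; rewrite mulrDr. Qed.

Lemma eq_span_eval f f' x : f =1 f' -> span_eval f x = span_eval f' x.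
Proof. by move=> e; apply: eq_bigr => w _; rewrite e. Qed.

Lemma span_eval_nsum_prepend (xs : seq F) (x : F) a z :
  span_eval (nsum (x :: xs)) (prepend a z) =
  span_eval (nsum xs) (prepend a z) + x ^+ a * span_eval (nsum xs) z.
Proof.
rewrite /prepend !span_eval_fglift -span_evalMl -span_eval_addf.
by apply: eq_span_eval => w; rewrite !span_eval1 nsum_cons.
Qed.

(** A pair of positions contributes to one of the three terms according to
    which comes first; the third one collects the coincidences. *)
Lemma nsum_stuffle_basis (xs : seq F) u v :
  span_eval (nsum xs) (stuffle_basis u v) = nsum xs u * nsum xs v.
Proof.
elim: xs u v => [|x xs IH] [|a u] [|b v]; rewrite ?stuffle_basis0l ?stuffle_basis0r ?span_eval1
  ?nsum_nil ?mul1r ?mulr1 //.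
- rewrite stuffle_basis_cons !span_evalD /= mulr0.
  have P0 c z : span_eval (nsum [::]) (prepend c z) = 0.
    rewrite /prepend span_eval_fglift (@eq_span_eval _ (fun=> 0 * 0)).
      by rewrite span_evalMl mul0r.
    by move=> w; rewrite span_eval1 mul0r.
  by rewrite !P0 !addr0.
- rewrite stuffle_basis_cons !span_evalD !span_eval_nsum_prepend !IH.
  have := IH (a :: u) (b :: v); rewrite stuffle_basis_cons !span_evalD => E.
  rewrite !nsum_cons exprD.
  have -> : (nsum xs (a :: u) + x ^+ a * nsum xs u) * (nsum xs (b :: v) + x ^+ b * nsum xs v)
    = nsum xs (a :: u) * nsum xs (b :: v) + x ^+ a * (nsum xs u * nsum xs (b :: v))
    + x ^+ b * (nsum xs (a :: u) * nsum xs v) + x ^+ a * x ^+ b * (nsum xs u * nsum xs v) by ring.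
  rewrite -E; ring.
Qed.

Lemma nsum_stuffle (xs : seq F) x y :
  span_eval (nsum xs) (stuffle x y) = span_eval (nsum xs) x * span_eval (nsum xs) y.
Proof.
rewrite /stuffle span_eval_fglift -span_evalMr; apply: eq_span_eval => u.
rewrite span_eval_fglift -span_evalMl; apply: eq_span_eval => v.
exact: nsum_stuffle_basis.
Qed.

Lemma nsum_stuffle_exp (xs : seq F) x l :
  span_eval (nsum xs) (stuffle_exp x l) = span_eval (nsum xs) x ^+ l.
Proof.
elim: l => [|l IH]; first by rewrite span_eval1 nsum_nil.
by rewrite /stuffle_exp iterS nsum_stuffle IH exprS.
Qed.

(** Truncated sums are thus polynomials in the truncated harmonic sum whose
    coefficients are truncations of convergent series. *)
Lemma nsum_decomposition (xs : seq F) k : is_index k ->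
  nsum xs k = \sum_(l < (size k).+1)
    span_eval (nsum xs) (stuffle_decomposition k l) * nsum xs [:: 1%N] ^+ l.
Proof.
move=> /stuffle_decompositionP [_ E].
rewrite -[LHS]span_eval1 E span_eval_sum; apply: eq_bigr => l _.
by rewrite nsum_stuffle nsum_stuffle_exp span_eval1.
Qed.

End Evaluation.

(** * Estimates *)

Section BigO.
Variables (K : numFieldType) (I : Type).
Implicit Types (D : I -> Prop) (w x y : I -> K).

Definition big_O D w x := exists c : nat, forall i, D i -> `|x i| <= c%:R * w i.

Lemma big_O_eq D w x y : (forall i, D i -> x i = y i) -> big_O D w x -> big_O D w y.
Proof. by move=> e [c xc]; exists c => i Di; rewrite -e ?xc. Qed.

Lemma big_OW D w w' x : (forall i, D i -> w i <= w' i) -> big_O D w x -> big_O D w' x.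
Proof.
move=> ww [c xc]; exists c => i Di; apply: le_trans (xc i Di) _.
by rewrite ler_wpM2l ?ler0n ?ww.
Qed.

Lemma big_O_wZ D w x (a : nat) : big_O D (fun i => a%:R * w i) x -> big_O D w x.
Proof. by move=> [c xc]; exists (c * a)%N => i Di; rewrite natrM -mulrA xc. Qed.

Lemma big_OD D w x y : big_O D w x -> big_O D w y -> big_O D w (fun i => x i + y i).
Proof.
move=> [c xc] [d yd]; exists (c + d)%N => i Di.
by rewrite natrD mulrDl (le_trans (ler_normD _ _)) // lerD ?xc ?yd.
Qed.

Lemma big_ON D w x : big_O D w x -> big_O D w (fun i => - x i).
Proof. by move=> [c xc]; exists c => i Di; rewrite normrN xc. Qed.

Lemma big_OM D w w' x y : big_O D w x -> big_O D w' y ->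
  big_O D (fun i => w i * w' i) (fun i => x i * y i).
Proof.
move=> [c xc] [d yd]; exists (c * d)%N => i Di.
by rewrite natrM mulrACA normrM ler_pM // ?xc ?yd.
Qed.

Lemma big_O0 D w : (forall i, D i -> 0 <= w i) -> big_O D w (fun=> 0).
Proof. by move=> w0; exists 0%N => i Di; rewrite normr0 mul0r. Qed.

Lemma big_O_sum D w (T : Type) (r : seq T) (P : pred T) (x : T -> I -> K) :
    (forall i, D i -> 0 <= w i) -> (forall j, P j -> big_O D w (x j)) ->
  big_O D w (fun i => \sum_(j <- r | P j) x j i).
Proof.
move=> w0 Ox; elim: r => [|j r IH].
  by apply: big_O_eq (big_O0 w0) => i _; rewrite big_nil.
have [Pj|Pj] := boolP (P j).
  by apply: big_O_eq (big_OD (Ox j Pj) IH) => i _; rewrite big_cons Pj.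
by apply: big_O_eq IH => i _; rewrite big_cons (negbTE Pj).
Qed.

End BigO.

Lemma big_O_comp (K : numFieldType) (I J : Type) (D : I -> Prop) (w x : I -> K)
    (f : J -> I) (D' : J -> Prop) :
  (forall j, D' j -> D (f j)) -> big_O D w x ->
  big_O D' (fun j => w (f j)) (fun j => x (f j)).
Proof. by move=> H [c xc]; exists c => j /H; apply: xc. Qed.

Section HurwitzBounds.
Variable K : numFieldType.
Implicit Types (q Q : nat) (k : seq nat).

Let always q := True.

(** A harmonic sum, playing the role of log q; the 1 makes its powers
    monotone in the exponent. *)
Definition lgw q : K := 1 + harm K q [:: 1%N].

Lemma pos_nodesS q : pos_nodes K q.+1 = rcons (pos_nodes K q) q.+1%:R.
Proof. by rewrite /pos_nodes -[in LHS]addn1 iotaD map_cat cats1. Qed.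

Lemma harm1E q : harm K q [:: 1%N] = \sum_(i < q) i.+1%:R^-1.
Proof.
elim: q => [|q IH]; first by rewrite big_ord0.
rewrite /harm pos_nodesS map_rcons -[[:: 1%N]]/(rcons [::] 1%N) nsum_rcons nsum_nil.
by rewrite mul1r expr1 big_ord_recr /= -IH.
Qed.

Lemma lgwS q : lgw q.+1 = lgw q + q.+1%:R^-1.
Proof. by rewrite /lgw !harm1E big_ord_recr addrA. Qed.

Lemma le_lgw q q' : (q <= q')%N -> lgw q <= lgw q'.
Proof.
move=> /subnK <-; elim: (q' - q)%N => // d IH.
by rewrite addSn lgwS ler_wpDr // invr_ge0 ler0n.
Qed.

Lemma lgw_ge1 q : 1 <= lgw q.
Proof. by apply: le_trans (le_lgw (leq0n q)); rewrite /lgw harm1E big_ord0 addr0. Qed.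

Lemma lgw_ge0 q : 0 <= lgw q.
Proof. exact: le_trans ler01 (lgw_ge1 q). Qed.

Lemma lgwX_ge0 q s : 0 <= lgw q ^+ s.
Proof. by rewrite exprn_ge0 // lgw_ge0. Qed.

Lemma le_lgwX q q' s s' : (q <= q')%N -> (s <= s')%N -> lgw q ^+ s <= lgw q' ^+ s'.
Proof.
move=> qq ss; apply: (@le_trans _ _ (lgw q' ^+ s)).
  by rewrite lerXn2r ?nnegrE ?lgw_ge0 ?le_lgw.
by rewrite ler_weXn2l ?lgw_ge1.
Qed.

(** Windows of size 2Q are measured by the logarithm of Q. *)
Lemma lgw_double q : lgw (q + q) <= 2%:R * lgw q.
Proof.
apply: (@le_trans _ _ (lgw q + 1)); last by rewrite mulr2n mulrDl mul1r lerD2l lgw_ge1.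
rewrite /lgw !harm1E big_split_ord /= -addrA lerD2l lerD2l.
apply: (@le_trans _ _ (\sum_(i < q) q.+1%:R^-1)).
  apply: ler_sum => i _; rewrite lef_pV2 ?posrE ?ltr0n // ler_nat.
  by rewrite ltnS leq_addr.
by rewrite sumr_const card_ord -[leLHS]mulr_natl ler_pdivrMr ?ltr0n // mul1r ler_nat.
Qed.

Lemma lgw_leX q Q s : (q <= Q + Q)%N -> lgw q ^+ s <= (2 ^ s)%N%:R * lgw Q ^+ s.
Proof.
move=> qQ; apply: le_trans (le_lgwX qQ (leqnn s)) _.
by rewrite natrX -exprMn lerXn2r ?nnegrE ?mulr_ge0 ?ler0n ?lgw_ge0 ?lgw_double.
Qed.

Lemma gbinom_bound a b : exists c : nat, `|gbinom (- a%:R : K) b| <= c%:R.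
Proof.
exists (\prod_(i < b) (a + i))%N.
rewrite /gbinom normrM normr_prod natr_prod normfV.
have -> : \prod_(i < b) `|- a%:R - i%:R : K| = \prod_(i < b) (a + i)%N%:R.
  by apply: eq_bigr => i _; rewrite -opprD normrN -natrD normr_nat.
rewrite ler_piMr //; first by apply: prodr_ge0 => i _; apply: ler0n.
by rewrite normr_nat invf_le1 ?ltr0n ?fact_gt0 // ler1n fact_gt0.
Qed.

Lemma yinv_bound a b : exists c : nat, forall n : K, 1 <= `|n| ->
  forall s, (s <= a + b)%N -> `|(yinv n ^+ a : fps K) b| <= c%:R * `|n|^-1 ^+ s.
Proof.
have [c gc] := gbinom_bound a b; exists c => n n1 s sab.
have n0 : n != 0 by rewrite -normr_gt0 (lt_le_trans ltr01).
rewrite yinv_exp_coef // normrM normrX normfV ler_pM ?exprn_ge0 ?invr_ge0 //.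
rewrite ler_wiXn2l ?invr_ge0 ?normr_ge0 //.
by rewrite invf_le1 // (lt_le_trans ltr01).
Qed.

Lemma hurwitz_rcons q k a :
  hurwitz K q.+1 (rcons k a) =
  hurwitz K q (rcons k a) + hurwitz K q k * yinv q.+1%:R ^+ a.
Proof. by rewrite /hurwitz pos_nodesS map_rcons nsum_rcons. Qed.

Lemma hurwitz_step_O k a b : (0 < a)%N ->
    (forall i, big_O always (fun q => lgw q ^+ size k) (fun q => hurwitz K q k i)) ->
  big_O always (fun q => lgw q ^+ size k * q.+1%:R^-1)
    (fun q => (hurwitz K q k * yinv q.+1%:R ^+ a) b).
Proof.
move=> a0 Hk; apply: big_O_sum => [q _|i _].
  by rewrite mulr_ge0 ?lgwX_ge0 ?invr_ge0 ?ler0n.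
apply: big_OM => //; have [c yc] := yinv_bound a (b - i); exists c => q _.
have /(_ _ 1%N) := yc q.+1%:R; rewrite normr_nat ler1n expr1; apply=> //.
by rewrite addn_gt0 a0.
Qed.

Lemma hurwitz_telescope k a b q q' : (q <= q')%N ->
  hurwitz K q' (rcons k a) b - hurwitz K q (rcons k a) b =
  \sum_(q <= t < q') (hurwitz K t k * yinv t.+1%:R ^+ a) b.
Proof.
move=> qq; rewrite -(telescope_sumr (fun t => hurwitz K t (rcons k a) b)) //.
by apply: eq_bigr => t _; rewrite hurwitz_rcons fpsDE addrC addKr.
Qed.

Lemma is_index_rcons k a : is_index (rcons k a) = is_index k && (0 < a)%N.
Proof. by rewrite /is_index all_rcons andbC. Qed.

(** Each step of the truncation adds one term with last variable q + 1, which
    is at most of order log^(r-1) q / q. *)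
Lemma hurwitz_O k b : is_index k ->
  big_O always (fun q => lgw q ^+ size k) (fun q => hurwitz K q k b).
Proof.
elim/last_ind: k b => [|k a IH] b.
  move=> _; exists 1%N => q _; rewrite /hurwitz nsum_nil mul1r expr0 fps1E.
  by rewrite normr_nat lern1; case: eqP.
rewrite is_index_rcons => /andP[ik a0]; rewrite size_rcons.
have [c stepc] := hurwitz_step_O b a0 (fun i => IH i ik); exists c => q _.
have -> : hurwitz K q (rcons k a) b = \sum_(0 <= t < q) (hurwitz K t k * yinv t.+1%:R ^+ a) b.
  rewrite -hurwitz_telescope // /hurwitz [X in _ - X]/=.
  by rewrite (_ : (rcons k a == [::]) = false) ?subr0 //; case: (k).
rewrite big_mkord (le_trans (ler_norm_sum _ _ _)) //.
apply: (@le_trans _ _ (\sum_(t < q) c%:R * (lgw q ^+ size k * t.+1%:R^-1))).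
  apply: ler_sum => t _; apply: le_trans (stepc _ _) _ => //.
  by rewrite !ler_wpM2l ?ler0n // ler_wpM2r ?invr_ge0 ?ler0n // le_lgwX // ltnW.
rewrite -mulr_sumr -mulr_sumr -harm1E exprSr !ler_wpM2l ?ler0n ?lgwX_ge0 //.
by rewrite /lgw lerDr.
Qed.

Lemma hurwitz_diff_O k b : is_index k ->
  big_O (fun p : nat * nat => p.1 <= p.2)%N
    (fun p => lgw p.2 ^+ size k * ((p.2 - p.1)%N%:R / p.1.+1%:R))
    (fun p => hurwitz K p.2 k b - hurwitz K p.1 k b).
Proof.
elim/last_ind: k => [|k a _].
  move=> _; exists 0%N => -[q q'] _ /=.
  by rewrite /hurwitz !nsum_nil subrr normr0 mul0r.
rewrite is_index_rcons => /andP[ik a0]; rewrite size_rcons.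
have [c stepc] := hurwitz_step_O b a0 (fun i => hurwitz_O i ik); exists c => -[q q'] /= qq.
rewrite hurwitz_telescope // (le_trans (ler_norm_sum _ _ _)) //.
apply: (@le_trans _ _ (\sum_(q <= t < q') c%:R * (lgw q' ^+ (size k).+1 * q.+1%:R^-1))).
  rewrite big_nat_cond [leRHS]big_nat_cond; apply: ler_sum => t /andP[/andP[qt tq] _].
  apply: le_trans (stepc _ _) _ => //; rewrite ler_wpM2l ?ler0n //.
  rewrite ler_pM ?lgwX_ge0 ?invr_ge0 ?ler0n ?le_lgwX // 1?ltnW //.
  by rewrite lef_pV2 ?posrE ?ltr0n // ler_nat.
by rewrite sumr_const_nat -[leLHS]mulr_natl !mulrA [_%:R * c%:R]mulrC -!mulrA
  ler_wpM2l ?ler0n // mulrCA.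
Qed.

(** With truncated subtractions, this is |i - Q|. *)
Definition offset Q i := ((i - Q) + (Q - i))%N.

Definition in_window (p : nat * nat) : Prop := (p.2 <= p.1 + p.1)%N.

(** Bounds, up to logarithms, the change of a truncated sum when its bound Q
    is moved by the offset: small near the centre, of order Q at the edges. *)
Definition edge_ratio Q i : K := (offset Q i)%:R / (Q.+1 - offset Q i)%N%:R.

Lemma edge_ratio_ge0 Q i : 0 <= edge_ratio Q i.
Proof. by rewrite divr_ge0 ?ler0n. Qed.

Lemma hurwitz_window_O k b : is_index k ->
  big_O in_window (fun p => lgw p.1 ^+ size k) (fun p => hurwitz K p.2 k b).
Proof.
move=> ik; apply: (@big_O_wZ _ _ _ _ _ (2 ^ size k)).
apply: (@big_OW _ _ _ (fun p => lgw p.2 ^+ size k)); first by move=> p; apply: lgw_leX.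
exact: (big_O_comp (D := always)) (hurwitz_O b ik).
Qed.

Lemma hurwitz_window_diff_O k b : is_index k ->
  big_O in_window (fun p => lgw p.1 ^+ size k * edge_ratio p.1 p.2)
    (fun p => hurwitz K p.2 k b - hurwitz K p.1 k b).
Proof.
move=> ik; have [c hc] := hurwitz_diff_O b ik; exists (c * 2 ^ size k)%N => -[Q i] /= iQ.
rewrite /in_window /= in iQ.
have [Qi|iQ'] := leqP Q i.
  apply: le_trans (hc (Q, i) Qi) _; rewrite /= natrM -mulrA ler_wpM2l ?ler0n // mulrA.
  rewrite ler_pM ?lgwX_ge0 ?divr_ge0 ?ler0n ?lgw_leX //.
  rewrite /edge_ratio /offset; have -> : (Q - i = 0)%N by lia.
  rewrite addn0 ler_wpM2l ?ler0n // lef_pV2 ?posrE ?ltr0n //; last by lia.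
  by rewrite ler_nat; lia.
rewrite distrC; apply: le_trans (hc (i, Q) (ltnW iQ')) _.
rewrite /= natrM -mulrA ler_wpM2l ?ler0n // mulrA.
rewrite ler_pM ?lgwX_ge0 ?divr_ge0 ?ler0n //.
  by rewrite ler_peMl ?lgwX_ge0 // ler1n expn_gt0.
rewrite /edge_ratio /offset; have -> : (i - Q = 0)%N by lia.
by rewrite add0n; have -> : (Q.+1 - (Q - i) = i.+1)%N by lia.
Qed.

Lemma fps_signM s (f : fps K) b : ((-1) ^+ s * f) b = (-1) ^+ s * f b.
Proof.
by rewrite -signr_odd -[in RHS]signr_odd; case: (odd s);
  rewrite ?expr0 ?mul1r // expr1 !mulN1r.
Qed.

Lemma is_index_take n k : is_index k -> is_index (take n k).
Proof. by rewrite -{1}(cat_take_drop n k) /is_index all_cat => /andP[]. Qed.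
Lemma is_index_drop n k : is_index k -> is_index (drop n k).
Proof. by rewrite -{1}(cat_take_drop n k) /is_index all_cat => /andP[]. Qed.
Lemma is_index_rev k : is_index (rev k) = is_index k.
Proof. exact: all_rev. Qed.

Lemma cutE p q k j h : cut K p q k j h =
  (-1) ^+ sumn (take j k) * \sum_(a < h.+1) (-1) ^+ a *
    hurwitz K p (rev (take j k)) a * hurwitz K q (drop j.+1 k) (h - a)%N.
Proof. by rewrite /cut hurwitz_neg -mulrA fps_signM fpsME. Qed.

(** A product changes by the change of each factor times the other factor. *)
Lemma cut_diff_O k j h : is_index k ->
  big_O in_window (fun p => lgw p.1 ^+ (size k + size k) * edge_ratio p.1 p.2)
    (fun p => cut K p.2 (p.1 + p.1 - p.2) k j h - cut K p.1 p.1 k j h).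
Proof.
move=> ik.
pose w (p : nat * nat) := lgw p.1 ^+ (size k + size k) * edge_ratio p.1 p.2.
have w0 p : 0 <= w p by rewrite mulr_ge0 ?lgwX_ge0 ?edge_ratio_ge0.
set u := rev (take j k); set v := drop j.+1 k.
have iu : is_index u by rewrite is_index_rev is_index_take.
have iv : is_index v by exact: is_index_drop.
have su : (size u <= size k)%N by rewrite size_rev size_take_min geq_minr.
have sv : (size v <= size k)%N by rewrite size_drop leq_subr.
apply: (@big_O_eq _ _ _ _ (fun p => (-1) ^+ sumn (take j k) * \sum_(a < h.+1) (-1) ^+ a *
    ((hurwitz K p.2 u a - hurwitz K p.1 u a) * hurwitz K (p.1 + p.1 - p.2) v (h - a)%N +
     hurwitz K p.1 u a * (hurwitz K (p.1 + p.1 - p.2) v (h - a)%N - hurwitz K p.1 v (h - a)%N)))).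
  move=> p _; rewrite !cutE -mulrBr -sumrB; congr (_ * _); apply: eq_bigr => a _.
  by rewrite -/u -/v; ring.
suff [c H] : big_O in_window w (fun p => \sum_(a < h.+1) (-1) ^+ a *
    ((hurwitz K p.2 u a - hurwitz K p.1 u a) * hurwitz K (p.1 + p.1 - p.2) v (h - a)%N +
     hurwitz K p.1 u a * (hurwitz K (p.1 + p.1 - p.2) v (h - a)%N - hurwitz K p.1 v (h - a)%N))).
  by exists c => p Dp; rewrite normrM normr_sign mul1r H.
apply: big_O_sum => // a _.
(* The right side of the i-th node has the size of the left side of its mirror image. *)
pose mirror (p : nat * nat) := (p.1, (p.1 + p.1 - p.2)%N).
have Dm p : in_window p -> in_window (mirror p) by rewrite /in_window /= leq_subr.
have wu s s' : (s <= size k)%N -> (s' <= size k)%N -> forall p, in_window p ->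
    lgw p.1 ^+ s * edge_ratio p.1 p.2 * lgw p.1 ^+ s' <= w p.
  move=> sk sk' p _; rewrite mulrAC -exprD ler_wpM2r ?edge_ratio_ge0 // le_lgwX //.
  exact: leq_add.
suff [c H] : big_O in_window w (fun p =>
    (hurwitz K p.2 u a - hurwitz K p.1 u a) * hurwitz K (p.1 + p.1 - p.2) v (h - a)%N +
     hurwitz K p.1 u a * (hurwitz K (p.1 + p.1 - p.2) v (h - a)%N - hurwitz K p.1 v (h - a)%N)).
  by exists c => p Dp; rewrite normrM normr_sign mul1r H.
apply: big_OD.
  apply: big_OW (wu _ _ su sv) _; apply: big_OM; first exact: hurwitz_window_diff_O.
  exact: (big_O_comp Dm (hurwitz_window_O (h - a) iv)).
apply: big_OW (wu _ _ sv su) _; apply: (@big_O_eq _ _ _ _ (fun p =>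
  (hurwitz K (p.1 + p.1 - p.2) v (h - a)%N - hurwitz K p.1 v (h - a)%N) * hurwitz K p.1 u a)).
  by move=> p _; rewrite mulrC.
apply: big_OM.
  apply: big_OW (big_O_comp Dm (hurwitz_window_diff_O (h - a) iv)).
  move=> [Q i] /= Dp; rewrite /in_window /= in Dp.
  by rewrite /edge_ratio (_ : offset Q (Q + Q - i) = offset Q i) // /offset; lia.
apply: (big_O_comp (D := in_window) (w := fun p => lgw p.1 ^+ size u)
  (x := fun p => hurwitz K p.2 u a) (f := fun p => (p.1, p.1))).
  by move=> p _; rewrite /in_window /= leq_addr.
exact: hurwitz_window_O.
Qed.

Lemma sum_offset (f : nat -> K) Q :
  \sum_(i < (Q + Q).+1) f (offset Q i) = f 0%N + 2%:R * \sum_(i < Q) f i.+1.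
Proof.
rewrite -(big_mkord xpredT (fun i => f (offset Q i))) (@big_cat_nat _ _ _ Q) //=; last by lia.
rewrite (@big_ltn _ _ _ Q) ?ltnS ?leq_addr // /offset subnn addn0 addrCA; congr (_ + _).
rewrite mulr2n mulrDl mul1r; congr (_ + _).
  rewrite big_mkord (reindex_inj rev_ord_inj); apply: eq_bigr => i _ /=.
  by congr f; have := ltn_ord i; lia.
rewrite -{1}[Q.+1]add0n big_addn subSS addnK big_mkord; apply: eq_bigr => i _.
by congr f; lia.
Qed.

(** Partial fractions of 1/(d (Q + 1 - d)) give twice a harmonic sum over
    Q + 1: the edges of the window do not accumulate. *)
Lemma sum_edge_ratio Q :
  \sum_(i < (Q + Q).+1) edge_ratio Q i * (offset Q i)%:R^-1 ^+ 2 <= 4%:R * lgw Q / Q.+1%:R.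
Proof.
pose f d : K := d%:R / (Q.+1 - d)%N%:R * d%:R^-1 ^+ 2.
rewrite (sum_offset f) {1}/f mul0r mul0r add0r.
have -> : \sum_(i < Q) f i.+1 = \sum_(i < Q) (i.+1%:R^-1 + (Q - i)%N%:R^-1) / Q.+1%:R.
  apply: eq_bigr => i _; rewrite /f subSS.
  have i0 : (i.+1%:R : K) != 0 by rewrite pnatr_eq0.
  have Qi0 : ((Q - i)%N%:R : K) != 0 by rewrite pnatr_eq0 subn_eq0 -ltnNge.
  have -> : Q.+1%:R = i.+1%:R + (Q - i)%N%:R :> K by rewrite -natrD addSn subnKC // ltnW.
  have s0 : i.+1%:R + (Q - i)%N%:R != 0 :> K by rewrite -natrD pnatr_eq0 addSn.
  move: (i.+1%:R : K) ((Q - i)%N%:R : K) i0 Qi0 s0 => x y x0 y0 s0.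
  by field; rewrite x0 y0 s0.
rewrite -mulr_suml big_split /=.
have -> : \sum_(i < Q) (Q - i)%N%:R^-1 = \sum_(i < Q) i.+1%:R^-1 :> K.
  rewrite (reindex_inj rev_ord_inj); apply: eq_bigr => i _ /=.
  by congr (_%:R^-1); have := ltn_ord i; lia.
rewrite -harm1E mulrA ler_wpM2r ?invr_ge0 ?ler0n //.
have -> x : x + x = 2%:R * x :> K by rewrite mulr2n mulrDl mul1r.
by rewrite mulrA -natrM ler_wpM2l ?ler0n // /lgw lerDr.
Qed.

End HurwitzBounds.

(** * A Riemann sum for pi *)

Section RiemannSum.
Variable R : realType.

Lemma atan_diff (x y : R) : 0 <= x -> x < y ->
  (y - x) / (1 + y ^+ 2) <= atan y - atan x <= (y - x) / (1 + x ^+ 2).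
Proof.
move=> x0 xy.
have ca : continuous (@atan R) by move=> z; exact: continuous_atan.
have [c] := @MVT R atan (fun x => (1 + x ^+ 2)^-1) x y xy
  (fun x _ => is_derive1_atan x) (continuous_subspaceT ca).
rewrite in_itv /= => /andP[xc cy] ->.
have c0 : 0 <= c by rewrite ltW // (le_lt_trans x0).
have y0 : 0 <= y by rewrite ltW // (le_lt_trans x0).
have p z : 0 < 1 + z ^+ 2 :> R by rewrite ltr_pwDl // sqr_ge0.
rewrite ![_^-1 * _]mulrC !ler_wpM2l ?subr_ge0 ?(ltW xy) //= lef_pV2 ?posrE ?p // lerD2l;
  by rewrite lerXn2r ?nnegrE // ltW.
Qed.

(** The complementary angle is atan (1/x), which is at most 1/x. *)
Lemma atan_inv (x : R) : 0 < x -> pi / 2 - x^-1 <= atan x.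
Proof.
move=> x0; have xV0 : 0 < x^-1 by rewrite invr_gt0.
have /andP[_] := @atan_diff 0 x^-1 (lexx _) xV0.
rewrite atan0 !subr0 expr0n /= addr0 divr1 => ale.
have a0 : 0 < atan x^-1 by rewrite -atan0 lt_atan.
have a1 : atan x^-1 < pi / 2 by exact: atan_ltpi2.
have -> : atan x = pi / 2 - atan x^-1.
  have ca : cos (atan x^-1) != 0.
    by rewrite gt_eqF // cos_gt0_pihalf // a1 andbT (lt_trans _ a0) // oppr_lt0 divr_gt0 ?pi_gt0.
  rewrite -[RHS]tanK; last first.
    rewrite in_itv /=; apply/andP; split; last by rewrite gtrBl.
    by rewrite ltrBrDr -subr_gt0; have := pi_gt0 R; lra.
  congr atan; rewrite /tan cosB sinB sin_pihalf cos_pihalf !mul0r !mul1r add0r subr0.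
  have := atanK x^-1; rewrite /tan => E.
  by rewrite -[RHS]invf_div E invrK.
by rewrite lerD2l lerN2.
Qed.

(** The terms M/(d^2 + M^2) bound the successive steps of atan (d/M),
    which goes from 0 to nearly pi/2 since d reaches M^2. *)
Lemma riemann_pi (M : nat) : (0 < M)%N ->
  `|M%:R^-1 + 2 * (\sum_(d < M ^ 2) M%:R / (d.+1%:R ^+ 2 + M%:R ^+ 2)) - pi| <= 5 / M%:R :> R.
Proof.
move=> M0; have m0 : 0 < M%:R :> R by rewrite ltr0n.
have mV0 : 0 < M%:R^-1 :> R by rewrite invr_gt0.
pose a d : R := atan (d%:R / M%:R).
pose t d : R := M%:R / (d%:R ^+ 2 + M%:R ^+ 2).
have t0 d : 0 <= t d by rewrite divr_ge0 ?ler0n // addr_ge0 // sqr_ge0.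
have step d : t d.+1 <= a d.+1 - a d <= t d.
  have dd : d%:R / M%:R < d.+1%:R / M%:R :> R by rewrite ltr_pM2r // ltr_nat.
  have d0 : 0 <= d%:R / M%:R :> R by rewrite divr_ge0 ?ler0n.
  have E e : (d.+1%:R / M%:R - d%:R / M%:R) / (1 + (e%:R / M%:R) ^+ 2) = t e.
    rewrite -mulrBl -natrB // subSnn mul1r /t.
    have mn0 : M%:R != 0 :> R by rewrite gt_eqF.
    have sn0 : e%:R ^+ 2 + M%:R ^+ 2 != 0 :> R.
      by rewrite gt_eqF // ltr_wpDl ?sqr_ge0 // exprn_gt0.
    have sn1 : 1 + (e%:R / M%:R) ^+ 2 != 0 :> R.
      by rewrite gt_eqF // ltr_pwDl // sqr_ge0.
    have -> : 1 + (e%:R / M%:R) ^+ 2 = (e%:R ^+ 2 + M%:R ^+ 2) / M%:R ^+ 2 :> R.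
      by move: (e%:R : R) (M%:R : R) mn0 => x y y0; field.
    by move: (e%:R : R) (M%:R : R) mn0 sn0 => x y y0 xy0; field; rewrite y0 xy0.
  by have := atan_diff d0 dd; rewrite !E.
rewrite -/(t _) (eq_bigr (fun d : 'I_(M ^ 2) => t d.+1)) //.
set S := \sum_(d < _) _.
have aS : \sum_(d < M ^ 2) (a d.+1 - a d) = atan M%:R.
  rewrite -(big_mkord xpredT (fun d => a d.+1 - a d)) telescope_sumr // /a mul0r atan0 subr0.
  by rewrite natrX expr2 mulfK ?gt_eqF.
have S1 : S <= atan M%:R by rewrite -aS; apply: ler_sum => d _; case/andP: (step d).
have S2 : atan M%:R <= S + M%:R^-1.
  have tM : t 0%N = M%:R^-1 by rewrite /t expr0n add0r expr2 invfM mulVKf ?gt_eqF.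
  have <- : \sum_(0 <= d < (M ^ 2).+1) t d = S + M%:R^-1.
    by rewrite big_ltn // tM addrC big_add1 /= big_mkord.
  rewrite big_nat_recr //= big_mkord -[leLHS]addr0 -aS lerD ?t0 //.
  by apply: ler_sum => d _; case/andP: (step d).
have := atan_inv m0; have := atan_ltpi2 (M%:R : R).
set A := atan _ in S1 S2 *; set m := M%:R^-1 in mV0 S2 *; set p := pi; clearbody S A m p => h1 h2.
by rewrite ler_norml; apply/andP; split; lra.
Qed.

End RiemannSum.

(** * Sequences negligible up to logarithms *)

Section Sequences.
Variable R : realType.
Local Notation C := R[i]%C.
Implicit Types (x y : nat -> C) (M Q : nat) (k : seq nat).

Definition positive M : Prop := (0 < M)%N.

(** The window goes from -M^2 to M^2 and the nested sums are evaluated at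
    heights M and -M: large against logarithms, small against the window. *)
Definition lgs M : C := lgw C (M ^ 2).

(** Being negligible up to a power of the logarithm is preserved by
    multiplication with any polynomial in the regularization parameter. *)
Definition plog x := exists J, big_O positive (fun M => lgs M ^+ J) x.
Definition tiny x := exists J, big_O positive (fun M => lgs M ^+ J / M%:R) x.

Lemma lgsX_ge0 J M : 0 <= lgs M ^+ J. Proof. exact: lgwX_ge0. Qed.
Lemma lgsXV_ge0 J M : 0 <= lgs M ^+ J / M%:R :> C.
Proof. by rewrite divr_ge0 ?lgsX_ge0 ?ler0n. Qed.

Lemma le_lgsX I J M : (I <= J)%N -> lgs M ^+ I <= lgs M ^+ J.
Proof. by move=> IJ; apply: le_lgwX. Qed.

Lemma plogW x J J' : (J <= J')%N -> big_O positive (fun M => lgs M ^+ J) x ->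
  big_O positive (fun M => lgs M ^+ J') x.
Proof. by move=> JJ; apply: big_OW => M _; apply: le_lgsX. Qed.

Lemma tinyW x J J' : (J <= J')%N -> big_O positive (fun M => lgs M ^+ J / M%:R) x ->
  big_O positive (fun M => lgs M ^+ J' / M%:R) x.
Proof.
by move=> JJ; apply: big_OW => M _; rewrite ler_wpM2r ?invr_ge0 ?ler0n ?le_lgsX.
Qed.

Lemma plog_eq x y : (forall M, (0 < M)%N -> x M = y M) -> plog x -> plog y.
Proof. by move=> e [J Ox]; exists J; apply: big_O_eq Ox. Qed.

Lemma tiny_eq x y : (forall M, (0 < M)%N -> x M = y M) -> tiny x -> tiny y.
Proof. by move=> e [J Ox]; exists J; apply: big_O_eq Ox. Qed.

Lemma plogD x y : plog x -> plog y -> plog (fun M => x M + y M).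
Proof.
move=> [I Ox] [J Oy]; exists (maxn I J).
by apply: big_OD; [apply: plogW Ox | apply: plogW Oy]; rewrite ?leq_maxl ?leq_maxr.
Qed.

Lemma tinyD x y : tiny x -> tiny y -> tiny (fun M => x M + y M).
Proof.
move=> [I Ox] [J Oy]; exists (maxn I J).
by apply: big_OD; [apply: tinyW Ox | apply: tinyW Oy]; rewrite ?leq_maxl ?leq_maxr.
Qed.

Lemma tinyN x : tiny x -> tiny (fun M => - x M).
Proof. by move=> [I Ox]; exists I; apply: big_ON. Qed.

Lemma tinyB x y : tiny x -> tiny y -> tiny (fun M => x M - y M).
Proof. by move=> tx ty; apply: tinyD => //; apply: tinyN. Qed.

Lemma tiny0 : tiny (fun=> 0).
Proof. by exists 0%N; apply: big_O0 => M _; apply: lgsXV_ge0. Qed.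

Lemma plogM x y : plog x -> plog y -> plog (fun M => x M * y M).
Proof.
move=> [I Ox] [J Oy]; exists (I + J)%N.
by apply: big_OW (big_OM Ox Oy) => M _; rewrite exprD.
Qed.

Lemma plog_tiny x y : plog x -> tiny y -> tiny (fun M => x M * y M).
Proof.
move=> [I Ox] [J Oy]; exists (I + J)%N.
by apply: big_OW (big_OM Ox Oy) => M _; rewrite exprD mulrA.
Qed.

Lemma tiny_plog x y : tiny x -> plog y -> tiny (fun M => x M * y M).
Proof. by move=> tx py; apply: tiny_eq (plog_tiny py tx) => M _; rewrite mulrC. Qed.

Lemma normc_nat_bound (c : C) : exists n : nat, `|c| <= n%:R.
Proof.
exists (Num.bound (Num.sqrt (complex.Re c ^+ 2 + complex.Im c ^+ 2))).
rewrite normc_def -(rmorph_nat (real_complex R)) lecR ltW //.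
by rewrite archi_boundP // sqrtr_ge0.
Qed.

Lemma plog_const c : plog (fun=> c).
Proof. by have [n cn] := normc_nat_bound c; exists 0%N, n => M _; rewrite expr0 mulr1. Qed.

Lemma tiny_invn : tiny (fun M => M%:R^-1).
Proof.
by exists 0%N, 1%N => M _; rewrite expr0 !mul1r ger0_norm // invr_ge0 ler0n.
Qed.

Lemma tinyW_plog x : tiny x -> plog x.
Proof.
move=> [J Ox]; exists J; apply: big_OW Ox => M M0.
by rewrite ler_piMr ?lgsX_ge0 // invf_le1 ?ltr0n // ler1n.
Qed.

Lemma tinyMl c x : tiny x -> tiny (fun M => c * x M).
Proof. exact/plog_tiny/plog_const. Qed.

Lemma plog_sum (T : Type) (r : seq T) (P : pred T) (x : T -> nat -> C) :
  (forall j, P j -> plog (x j)) -> plog (fun M => \sum_(j <- r | P j) x j M).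
Proof.
move=> Px; elim: r => [|j r IH].
  by apply: plog_eq (plog_const 0) => M _; rewrite big_nil.
have [Pj|Pj] := boolP (P j).
  by apply: plog_eq (plogD (Px j Pj) IH) => M _; rewrite big_cons Pj.
by apply: plog_eq IH => M _; rewrite big_cons (negbTE Pj).
Qed.

Lemma tiny_sum (T : Type) (r : seq T) (P : pred T) (x : T -> nat -> C) :
  (forall j, P j -> tiny (x j)) -> tiny (fun M => \sum_(j <- r | P j) x j M).
Proof.
move=> Px; elim: r => [|j r IH].
  by apply: tiny_eq tiny0 => M _; rewrite big_nil.
have [Pj|Pj] := boolP (P j).
  by apply: tiny_eq (tinyD (Px j Pj) IH) => M _; rewrite big_cons Pj.
by apply: tiny_eq IH => M _; rewrite big_cons (negbTE Pj).
Qed.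

Lemma hurwitz_plog k b : is_index k -> plog (fun M => hurwitz C (M ^ 2) k b).
Proof.
move=> ik; exists (size k); have [c H] := @hurwitz_O C k b ik.
by exists c => M _; apply: H.
Qed.

Lemma cut_plog k j h : is_index k -> plog (fun M => cut C (M ^ 2) (M ^ 2) k j h).
Proof.
move=> ik; have iu : is_index (rev (take j k)) by rewrite is_index_rev is_index_take.
have iv : is_index (drop j.+1 k) by apply: is_index_drop.
apply: (@plog_eq (fun M => (-1) ^+ sumn (take j k) * \sum_(a < h.+1)
   (-1) ^+ a * hurwitz C (M ^ 2) (rev (take j k)) a *
     hurwitz C (M ^ 2) (drop j.+1 k) (h - a)%N)) => [M _|]; first by rewrite cutE.
apply: plogM; first exact: plog_const.
apply: plog_sum => a _.
by apply: plogM; [apply: plogM; [exact: plog_const|exact: hurwitz_plog]|exact: hurwitz_plog].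
Qed.

(** The residues of the nested sums over two windows of the same length
    differ mostly near the edges, where a weight decaying quadratically is
    small. *)
Lemma window_tiny k j h (g : nat -> nat -> C) : is_index k ->
    (exists c : nat, forall M i, (0 < M)%N -> i != (M ^ 2)%N ->
       `|g M i| <= c%:R * M%:R * (offset (M ^ 2) i)%:R^-1 ^+ 2) ->
  tiny (fun M => \sum_(i < (M ^ 2 + M ^ 2).+1)
    (cut C i (M ^ 2 + M ^ 2 - i) k j h - cut C (M ^ 2) (M ^ 2) k j h) * g M i).
Proof.
move=> ik [c gc]; have [d Hd] := @cut_diff_O C k j h ik.
exists (size k + size k).+1, (d * c * 4)%N => M M0.
apply: le_trans (ler_norm_sum _ _ _) _.
apply: (@le_trans _ _ (\sum_(i < (M ^ 2 + M ^ 2).+1)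
  d%:R * lgs M ^+ (size k + size k) * c%:R * M%:R *
    (edge_ratio C (M ^ 2) i * (offset (M ^ 2) i)%:R^-1 ^+ 2))).
  apply: ler_sum => i _; rewrite normrM.
  have := Hd ((M ^ 2)%N, i : nat); rewrite /in_window /= -ltnS => /(_ (ltn_ord i)) Hi.
  (* At the centre the two residues coincide, while g is unconstrained. *)
  have [iQ|iQ] := eqVneq (i : nat) (M ^ 2)%N.
    move: Hi; rewrite iQ /edge_ratio /offset subnn mul0r mulr0 mulr0 normr_le0 => /eqP ->.
    by rewrite normr0 !mul0r mulr0.
  apply: le_trans (ler_pM (normr_ge0 _) (normr_ge0 _) Hi (gc M i M0 iQ)) _.
  by rewrite -/(lgs M); move: (edge_ratio _ _ _) => E; rewrite !mulrA !(mulrAC _ E).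
rewrite -mulr_sumr.
have d0 : 0 <= d%:R * lgs M ^+ (size k + size k) * c%:R * M%:R :> C.
  by rewrite !mulr_ge0 ?ler0n ?lgsX_ge0.
apply: le_trans (ler_wpM2l d0 (sum_edge_ratio C (M ^ 2))) _.
rewrite -/(lgs M) exprSr !natrM.
set l := lgs M; set L := l ^+ _; set m : C := M%:R.
have -> : d%:R * L * c%:R * m * (4 * l / (M ^ 2).+1%:R) =
          (d%:R * c%:R * 4 * (L * l)) * (m / (M ^ 2).+1%:R) by ring.
rewrite [leRHS]mulrA ler_wpM2l //.
  by rewrite !mulr_ge0 ?ler0n ?lgsX_ge0 // /l -[lgs M]expr1 lgsX_ge0.
rewrite ler_pdivrMr ?ltr0n // mulrC ler_pdivlMr ?ltr0n //.
by rewrite /m -natrM ler_nat mulnn.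
Qed.

(** All poles are given the coefficients of the node 0. *)
Definition central_polar (xi : C -> nat -> C) Q k : C :=
  \sum_(j < size k) \sum_(h < nth 0%N k j)
    cut C Q Q k j h * \sum_(i < (Q + Q).+1) xi (i%:R - Q%:R) (nth 0%N k j - h)%N.

Lemma window_polar_diff (xi : C -> nat -> C) Q k :
  window_polar xi Q k - central_polar xi Q k =
  \sum_(j < size k) \sum_(h < nth 0%N k j) \sum_(i < (Q + Q).+1)
    (cut C i (Q + Q - i) k j h - cut C Q Q k j h) * xi (i%:R - Q%:R) (nth 0%N k j - h)%N.
Proof.
rewrite /window_polar exchange_big /= -sumrB; apply: eq_bigr => j _.
rewrite exchange_big /= -sumrB; apply: eq_bigr => h _.
by rewrite mulr_sumr -sumrB; apply: eq_bigr => i _; rewrite mulrBl.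
Qed.

Lemma window_polar_tiny (xi : nat -> C -> nat -> C) k : is_index k ->
    (forall e, (0 < e)%N -> exists c : nat, forall M i, (0 < M)%N -> i != (M ^ 2)%N ->
       `|xi M (i%:R - (M ^ 2)%N%:R) e| <= c%:R * M%:R * (offset (M ^ 2) i)%:R^-1 ^+ 2) ->
  tiny (fun M => window_polar (xi M) (M ^ 2) k - central_polar (xi M) (M ^ 2) k).
Proof.
move=> ik Hxi; apply: (@tiny_eq (fun M => \sum_(j < size k) \sum_(h < nth 0%N k j)
  \sum_(i < (M ^ 2 + M ^ 2).+1)
    (cut C i (M ^ 2 + M ^ 2 - i) k j h - cut C (M ^ 2) (M ^ 2) k j h)
      * xi M (i%:R - (M ^ 2)%N%:R) (nth 0%N k j - h)%N)).
  by move=> M _; rewrite window_polar_diff.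
apply: tiny_sum => j _; apply: tiny_sum => h _.
apply: (@window_tiny k j h (fun M i => xi M (i%:R - (M ^ 2)%N%:R) (nth 0%N k j - h)%N)) => //.
by apply: Hxi; rewrite subn_gt0.
Qed.

(** * Nested sums far from the real axis *)

(** Both signs are used: the simple poles cancel between iM and -iM. *)
Definition vertical (s : bool) M : C := Complex 0 ((-1) ^+ s * M%:R).

Definition vpoint s M i : C := i%:R - (M ^ 2)%N%:R + vertical s M.

Lemma vpointE s M i : vpoint s M i = Complex (i%:R - (M ^ 2)%N%:R) ((-1) ^+ s * M%:R).
Proof.
rewrite /vpoint /vertical -!(rmorph_nat (real_complex R)) -rmorphB.
by apply/eqP; rewrite eq_complex /= addr0 add0r !eqxx.
Qed.

Lemma offset_sqr Q i : (i%:R - Q%:R) ^+ 2 = (offset Q i)%:R ^+ 2 :> R.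
Proof.
rewrite /offset; have [Qi|iQ] := leqP Q i.
  by have /eqP -> := Qi; rewrite addn0 natrB.
have /eqP -> := ltnW iQ; rewrite add0n natrB; last exact: ltnW.
by rewrite -[LHS]sqrrN opprB.
Qed.

Lemma norm_offset Q i : `|i%:R - Q%:R : C| = (offset Q i)%:R.
Proof.
apply/eqP; rewrite -(eqrXn2 (n := 2)) ?normr_ge0 ?ler0n //.
rewrite -!(rmorph_nat (real_complex R)) -rmorphB -add_Re2_Im2 /= expr0n addr0.
by rewrite offset_sqr rmorphXn.
Qed.

Lemma norm_vpoint_sqr s M i : `|vpoint s M i| ^+ 2 = (offset (M ^ 2) i ^ 2 + M ^ 2)%N%:R.
Proof.
rewrite -add_Re2_Im2 vpointE /= offset_sqr exprMn sqrr_sign mul1r natrD !natrX.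
by rewrite rmorphD !rmorphXn !rmorph_nat.
Qed.

Lemma norm_vpoint_ge s M i a : (a <= offset (M ^ 2) i)%N || (a <= M)%N -> a%:R <= `|vpoint s M i|.
Proof.
move=> aM; rewrite -(@ler_pXn2r _ 2) ?nnegrE ?normr_ge0 ?ler0n // norm_vpoint_sqr -natrX ler_nat.
case/orP: aM => aM; [apply: leq_trans (leq_addr _ _)|apply: leq_trans (leq_addl _ _)];
  by rewrite leq_exp2r.
Qed.

Lemma vpoint_neq0 s M i : (0 < M)%N -> vpoint s M i != 0.
Proof.
move=> M0; rewrite -normr_gt0; apply: lt_le_trans ltr01 _.
by apply: (@norm_vpoint_ge s M i 1); rewrite M0 orbT.
Qed.

Lemma norm_vpointV_le s M i a : (0 < a)%N -> (a <= offset (M ^ 2) i)%N || (a <= M)%N ->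
  `|(vpoint s M i)^-1| <= a%:R^-1.
Proof.
move=> a0 aM; rewrite normfV lef_pV2 ?posrE ?ltr0n ?norm_vpoint_ge //.
by rewrite (lt_le_trans _ (norm_vpoint_ge s aM)) // ltr0n.
Qed.

Lemma norm_vpointV_le1 s M i : (0 < M)%N -> `|(vpoint s M i)^-1| <= 1.
Proof.
by move=> M0; rewrite -[leRHS]invr1; apply: (@norm_vpointV_le s M i 1); rewrite // M0 orbT.
Qed.

(** The nested sums of [vrecips s M] are those over the window, at the point
    [vertical s M]. *)
Definition vrecips s M : seq C := [seq (n + vertical s M)^-1 | n <- window C (M ^ 2)].

Lemma vrecips_sum s M (f : C -> C) :
  \sum_(x <- vrecips s M) f x = \sum_(i < (M ^ 2 + M ^ 2).+1) f (vpoint s M i)^-1.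
Proof.
rewrite /vrecips big_map (big_nth 0) size_window big_mkord; apply: eq_bigr => i _.
by rewrite nth_window.
Qed.

(** Away from the centre, |n + iM| >= |n|. *)
Lemma vrecips_norm_plog s : plog (fun M => \sum_(x <- vrecips s M) `|x|).
Proof.
exists 1%N, 2%N => M M0; rewrite expr1 vrecips_sum.
pose f d : C := if d == 0%N then 1 else d%:R^-1.
rewrite ger0_norm; last by apply: sumr_ge0 => i _; apply: normr_ge0.
apply: (@le_trans _ _ (\sum_(i < (M ^ 2 + M ^ 2).+1) f (offset (M ^ 2) i))).
  apply: ler_sum => i _; rewrite /f; case: eqP => [_|/eqP o0].
    exact: norm_vpointV_le1.
  by apply: norm_vpointV_le; rewrite ?leqnn // lt0n.
rewrite sum_offset /f /= -harm1E /lgs /lgw.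
by rewrite mulrDr lerD2r mulr1 ler1n.
Qed.

Lemma natc_real n : (n%:R : C) = (n%:R : R)%:C%C.
Proof. by rewrite rmorph_nat. Qed.

(** M times the sum of 1/(n^2 + M^2) over the window, with the opposite nodes
    grouped. *)
Definition cauchy_sum M : R :=
  M%:R^-1 + 2 * (\sum_(d < M ^ 2) M%:R / (d.+1%:R ^+ 2 + M%:R ^+ 2)).

Lemma cauchy_sumE M : (0 < M)%N ->
  \sum_(i < (M ^ 2 + M ^ 2).+1) ((offset (M ^ 2) i ^ 2 + M ^ 2)%N%:R)^-1 =
  (cauchy_sum M)%:C%C / M%:R :> C.
Proof.
move=> M0; have m0 : (M%:R : R) != 0 by rewrite pnatr_eq0 -lt0n.
pose f d : R := (d ^ 2 + M ^ 2)%N%:R^-1.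
transitivity ((\sum_(i < (M ^ 2 + M ^ 2).+1) f (offset (M ^ 2) i))%:C%C : C).
  by rewrite rmorph_sum; apply: eq_bigr => i _; rewrite fmorphV rmorph_nat.
rewrite sum_offset natc_real -fmorphV -rmorphM; congr (_%:C)%C.
rewrite /cauchy_sum /f [RHS]mulrDl -[2 * _ / _]mulrA mulr_suml; congr (_ + _ * _).
  by rewrite exp0n // add0n natrX expr2 invfM.
apply: eq_bigr => d _; rewrite natrD !natrX mulrAC mulfV // mul1r.
by [].
Qed.

Lemma cauchy_sum_tiny : tiny (fun M => (cauchy_sum M)%:C%C - (pi : R)%:C%C).
Proof.
exists 0%N, 5%N => M M0; rewrite expr0 mul1r -rmorphB normc_def /= expr0n addr0 sqrtr_sqr.
have := @riemann_pi R M M0; rewrite -lecR.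
by rewrite rmorphM fmorphV !rmorph_nat.
Qed.

Lemma cauchy_sum_plog : plog (fun M => (cauchy_sum M)%:C%C).
Proof.
apply: plog_eq (plogD (tinyW_plog cauchy_sum_tiny) (plog_const (pi : R)%:C%C)) => M _.
by rewrite subrK.
Qed.

Lemma vrecips_norm_sqr_tiny s : tiny (fun M => \sum_(x <- vrecips s M) `|x| ^+ 2).
Proof.
apply: tiny_eq (plog_tiny cauchy_sum_plog tiny_invn) => M M0.
rewrite vrecips_sum -cauchy_sumE //; apply: eq_bigr => i _.
by rewrite normfV exprVn norm_vpoint_sqr.
Qed.

(** The partial sums of the cotangent series tend to -i pi at iM and to i pi
    at -iM. *)
Lemma vrecips_sum_tiny s :
  tiny (fun M => \sum_(x <- vrecips s M) x - Complex 0 (- (-1) ^+ s * pi)).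
Proof.
apply: tiny_eq (tinyMl (Complex 0 (- (-1) ^+ s)) cauchy_sum_tiny) => M M0.
rewrite (vrecips_sum _ _ id).
have invE i : (vpoint s M i)^-1 = (i%:R - (M ^ 2)%N%:R) / (offset (M ^ 2) i ^ 2 + M ^ 2)%N%:R
    + Complex 0 (- (-1) ^+ s * M%:R) / (offset (M ^ 2) i ^ 2 + M ^ 2)%N%:R.
  rewrite invc_norm norm_vpoint_sqr vpointE /= mulrC -mulrDl; congr (_ / _).
  rewrite -!(rmorph_nat (real_complex R)) -rmorphB; apply/eqP; rewrite eq_complex /=.
  by rewrite addr0 add0r mulNr !eqxx.
under eq_bigr do rewrite invE.
(* The real parts cancel under n -> -n. *)
have odd0 : \sum_(i < (M ^ 2 + M ^ 2).+1)
    (i%:R - (M ^ 2)%N%:R : C) / (offset (M ^ 2) i ^ 2 + M ^ 2)%N%:R = 0.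
  set S := \sum_(i < _) _; suff SN : S = - S.
    have : S *+ 2 == 0 by rewrite mulr2n {1}SN addNr.
    by rewrite mulrn_eq0 => /eqP.
  rewrite {1}/S (reindex_inj rev_ord_inj) -sumrN; apply: eq_bigr => i _ /=.
  have iQ : (i <= M ^ 2 + M ^ 2)%N by rewrite -ltnS.
  rewrite subSS natrB // (_ : offset _ (_ - i) = offset (M ^ 2) i); last by rewrite /offset; lia.
  by rewrite -mulNr natrD; congr (_ / _); ring.
rewrite big_split /= odd0 add0r -mulr_sumr cauchy_sumE //.
rewrite mulrBr; congr (_ - _); last first.
  by apply/eqP; rewrite eq_complex /= !mul0r !mulr0 subrr add0r !eqxx.
rewrite mulrA mulrAC; congr (_ * _).
have m0 : (M%:R : R) != 0 by rewrite pnatr_eq0 -lt0n.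
rewrite natc_real -fmorphV; apply/eqP; rewrite eq_complex /= !mul0r !mulr0 subrr add0r.
by rewrite mulfK // !eqxx.
Qed.

(** * Limits of the nested sums *)

Lemma index_norm_sum_plog s a : (0 < a)%N ->
  plog (fun M => \sum_(x <- vrecips s M) `|x| ^+ a).
Proof.
move=> a0; have [J [c Ox]] := vrecips_norm_plog s; exists J, c => M M0.
apply: le_trans (Ox M M0); rewrite !ger0_norm; try by apply: sumr_ge0 => x _; rewrite ?exprn_ge0.
rewrite !(vrecips_sum _ _ (fun z : C => `|z| ^+ _)) (vrecips_sum _ _ (fun z : C => `|z|)).
apply: ler_sum => i _; rewrite -[leRHS]expr1 ler_wiXn2l //.
exact: norm_vpointV_le1.
Qed.

Lemma index_norm_sum_tiny s a : (1 < a)%N ->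
  tiny (fun M => \sum_(x <- vrecips s M) `|x| ^+ a).
Proof.
move=> a0; have [J [c Ox]] := vrecips_norm_sqr_tiny s; exists J, c => M M0.
apply: le_trans (Ox M M0); rewrite !ger0_norm; try by apply: sumr_ge0 => x _; rewrite ?exprn_ge0.
rewrite !(vrecips_sum _ _ (fun z : C => `|z| ^+ _)).
apply: ler_sum => i _; rewrite ler_wiXn2l //.
exact: norm_vpointV_le1.
Qed.

Lemma tiny_norm_le x y : (forall M, (0 < M)%N -> `|x M| <= `|y M|) -> tiny y -> tiny x.
Proof. by move=> xy [J [c Oy]]; exists J, c => M M0; apply: le_trans (xy M M0) (Oy M M0). Qed.

(** One entry larger than 1 brings a factor of order 1/M, the others at most
    logarithms. *)
Lemma nsum_vrecips_tiny s k : is_index k -> has (leq 2) k -> tiny (fun M => nsum (vrecips s M) k).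
Proof.
move=> ik hk; apply: (@tiny_norm_le _ (fun M => \prod_(a <- k) \sum_(x <- vrecips s M) `|x| ^+ a)).
  move=> M _; rewrite [leRHS]ger0_norm ?normr_nsum_le //.
  by apply: prodr_ge0 => a _; apply: sumr_ge0 => x _; rewrite exprn_ge0.
elim: k ik hk => // a k IH /= /andP[a0 ik] /orP[a2|hk].
  apply: (@tiny_eq (fun M => (\sum_(x <- vrecips s M) `|x| ^+ a) *
    \prod_(b <- k) \sum_(x <- vrecips s M) `|x| ^+ b)); first by move=> M _; rewrite big_cons.
  apply: tiny_plog; first exact: index_norm_sum_tiny.
  elim: k ik {IH} => [_|b k IH /= /andP[b0 ik]].
    by apply: plog_eq (plog_const 1) => M _; rewrite big_nil.
  apply: plog_eq (plogM (index_norm_sum_plog s b0) (IH ik)) => M _.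
  by rewrite big_cons.
apply: tiny_eq (plog_tiny (index_norm_sum_plog s a0) (IH ik hk)) => M _.
by rewrite big_cons.
Qed.

(** Multiplying by the sum of order one gives p + 1 times the next elementary
    symmetric function, up to sums with an entry 2, which are negligible. *)
Lemma nsum_vrecips_ones_tiny s p :
  tiny (fun M => nsum (vrecips s M) (nseq p 1%N)
                 - Complex 0 (- (-1) ^+ s * pi) ^+ p / p`!%:R).
Proof.
set c := Complex _ _; elim: p => [|p IH].
  by apply: tiny_eq tiny0 => M _; rewrite nsum_nil expr0 fact0 divr1 subrr.
have p0 : (p.+1%:R : C) != 0 by rewrite pnatr_eq0.
have sum1 M : \sum_(x <- vrecips s M) x = nsum (vrecips s M) [:: 1%N].
  elim: (vrecips s M) => [|x xs IHx]; first by rewrite big_nil.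
  by rewrite big_cons IHx nsum_cons nsum_nil mulr1 expr1 addrC.
have t1 : tiny (fun M => nsum (vrecips s M) [:: 1%N] - c).
  by apply: tiny_eq (vrecips_sum_tiny s) => M _; rewrite sum1.
have p1 : plog (fun M => nsum (vrecips s M) (nseq p 1%N)).
  apply: plog_eq (plogD (tinyW_plog IH) (plog_const (c ^+ p / p`!%:R))) => M _.
  by rewrite subrK.
have [y yP E] := mulone_ones p.
have ty : tiny (fun M => span_eval (nsum (vrecips s M)) y).
  move: y yP {E}; apply: in_span_ind.
  - by apply: tiny_eq tiny0 => M _; rewrite span_eval0.
  - by move=> x y tx ty; apply: tiny_eq (tinyD tx ty) => M _; rewrite span_evalD.
  move=> d w [iw _ hw]; apply: tiny_eq (tinyMl (ratr d) (nsum_vrecips_tiny s iw hw)) => M _.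
  by rewrite span_evalZ span_eval1.
apply: tiny_eq (tinyMl p.+1%:R^-1 (tinyB (tinyD (tiny_plog t1 p1) (tinyMl c IH)) ty)) => M _ /=.
have Ev : nsum (vrecips s M) [:: 1%N] * nsum (vrecips s M) (nseq p 1%N) =
    p.+1%:R * nsum (vrecips s M) (nseq p.+1 1%N) + span_eval (nsum (vrecips s M)) y.
  rewrite -[nsum _ [:: _]]span_eval1 -[X in _ * X]span_eval1 -nsum_stuffle E.
  by rewrite span_evalD span_evalZ span_eval1 ratr_nat.
rewrite factS natrM exprS invfM mulrBl Ev.
rewrite -/(nseq p.+1 1%N) -[1%N :: nseq p 1%N]/(nseq p.+1 1%N).
set A := nsum _ (nseq p.+1 _); set B := nsum _ (nseq p _); set Y := span_eval _ _.
move: (p`!%:R^-1 : C) (p.+1%:R : C) p0 => f q q0.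
by field.
Qed.

End Sequences.

(** * The limit of the truncated identity *)

Section TruncatedTheta.
Variable R : realType.
Local Notation C := R[i]%C.
Implicit Types (M Q : nat) (k : seq nat).

(** Theta for sums truncated at Q: the coefficient of s^m in the multitangent
    sum over the window minus its principal part at 0, transported to all
    nodes. *)
Definition theta_trunc Q m k : C :=
  nsum (map (@yinv C) (neg_nodes C Q ++ pos_nodes C Q)) k m
  + \sum_(j < size k) cut C Q Q k j (m + nth 0%N k j)%N
  - central_polar (laurent_coef 1 m) Q k.

Lemma theta_trunc_nil Q m : theta_trunc Q m [::] = (m == 0%N)%:R.
Proof. by rewrite /theta_trunc /central_polar nsum_nil !big_ord0 subr0 addr0 fps1E. Qed.

Lemma theta_truncE Q m k : k != [::] -> is_index k ->
  theta_trunc Q m k =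
  window_polar (laurent_coef 1 m) Q k - central_polar (laurent_coef 1 m) Q k.
Proof. by move=> k0 ik; rewrite /theta_trunc -window_identity. Qed.

Lemma offset_gt0 Q i : i != Q -> (0 < offset Q i)%N.
Proof. by move=> iQ; rewrite /offset; lia. Qed.

(** For m > 0 the coefficients of s^m in 1/(s + n)^e decay at least like
    1/n^2. *)
Lemma theta_trunc_pos_tiny m k : (0 < m)%N -> k != [::] -> is_index k ->
  tiny (fun M => theta_trunc (M ^ 2) m k).
Proof.
move=> m0 k0 ik.
apply: tiny_eq (@window_polar_tiny R (fun=> laurent_coef 1 m) k ik _) => [M _|e e0].
  by rewrite theta_truncE.
have [c yc] := @yinv_bound C e m; exists c => M i M0 iQ.
have o0 := offset_gt0 iQ.
rewrite /laurent_coef -normr_eq0 norm_offset pnatr_eq0 -leqn0 leqNgt o0 /= mul1r.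
have := yc (i%:R - (M ^ 2)%N%:R); rewrite norm_offset ler1n => /(_ o0 2%N) H.
apply: le_trans (H _) _; first by lia.
by rewrite ler_wpM2r ?exprn_ge0 ?invr_ge0 ?ler0n // ler_peMr ?ler0n // ler1n.
Qed.

Definition vertical_power s M (n : C) e : C := (n + vertical R s M)^-1 ^+ e.

(** For e = 1 neither term is summable, but the difference
    1/n - 1/(n + iM) is of order M/n^2. *)
Lemma laurent_vertical_bound s e : (0 < e)%N ->
  exists c : nat, forall M i, (0 < M)%N -> i != (M ^ 2)%N ->
    `|laurent_coef 1 0 (i%:R - (M ^ 2)%N%:R) e
      - vertical_power s M (i%:R - (M ^ 2)%N%:R) e|
    <= c%:R * M%:R * (offset (M ^ 2) i)%:R^-1 ^+ 2.
Proof.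
move=> e0; exists 2%N => M i M0 iQ; have o0 := offset_gt0 iQ.
have n0 : i%:R - (M ^ 2)%N%:R != 0 :> C by rewrite -normr_gt0 norm_offset ltr0n.
rewrite /laurent_coef (negbTE n0) mul1r yinv_exp_coef // addn0.
rewrite /gbinom big_ord0 invr1 !mul1r /vertical_power -/(vpoint R s M i).
have zo : `|(vpoint R s M i)^-1| <= (offset (M ^ 2) i)%:R^-1.
  by apply: norm_vpointV_le => //; rewrite leqnn.
have no : `|(i%:R - (M ^ 2)%N%:R : C)^-1| = (offset (M ^ 2) i)%:R^-1.
  by rewrite normfV norm_offset.
have o1 : (offset (M ^ 2) i)%:R^-1 <= 1 :> C by rewrite invf_le1 ?ltr0n // ler1n.
have oV0 : 0 <= (offset (M ^ 2) i)%:R^-1 :> C by rewrite invr_ge0 ler0n.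
case: e e0 => [//|[|e]] _.
  rewrite !expr1.
  have -> : (i%:R - (M ^ 2)%N%:R)^-1 - (vpoint R s M i)^-1 =
      vertical R s M * ((i%:R - (M ^ 2)%N%:R)^-1 * (vpoint R s M i)^-1).
    have z0 := vpoint_neq0 R s i M0; rewrite /vpoint in z0 *.
    by move: (_ - _ : C) (vertical R s M) n0 z0 => x y x0 xy0; field; rewrite xy0.
  have vM : `|vertical R s M| = M%:R.
    rewrite normc_def /= expr0n add0r sqrtr_sqr normrM normr_sign mul1r ger0_norm //.
    exact: rmorph_nat.
  rewrite !normrM vM no -mulrA -natr1 mulrDl mul1r -[leLHS]add0r.
  rewrite lerD ?mulr_ge0 ?ler0n ?exprn_ge0 // expr2.
  by rewrite !ler_wpM2l ?ler0n.
apply: le_trans (ler_normB _ _) _; rewrite !normrX no.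
apply: (@le_trans _ _ ((offset (M ^ 2) i)%:R^-1 ^+ 2 + (offset (M ^ 2) i)%:R^-1 ^+ 2)).
  apply: lerD; first by rewrite ler_wiXn2l.
  apply: (@le_trans _ _ ((offset (M ^ 2) i)%:R^-1 ^+ e.+2)); last by rewrite ler_wiXn2l.
  by rewrite lerXn2r ?nnegrE.
have -> x : x + x = 2%:R * x :> C by rewrite mulr2n mulrDl mul1r.
rewrite ler_wpM2r ?exprn_ge0 //.
by rewrite ler_peMr ?ler0n // ler1n.
Qed.

Lemma window_polarB (xi1 xi2 : C -> nat -> C) Q k :
  window_polar (fun n e => xi1 n e - xi2 n e) Q k = window_polar xi1 Q k - window_polar xi2 Q k.
Proof.
rewrite /window_polar -sumrB; apply: eq_bigr => i _.
rewrite -sumrB; apply: eq_bigr => j _.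
by rewrite -sumrB; apply: eq_bigr => h _; rewrite mulrBr.
Qed.

Lemma central_polarB (xi1 xi2 : C -> nat -> C) Q k :
  central_polar (fun n e => xi1 n e - xi2 n e) Q k = central_polar xi1 Q k - central_polar xi2 Q k.
Proof.
rewrite /central_polar -sumrB; apply: eq_bigr => j _.
by rewrite -sumrB; apply: eq_bigr => h _; rewrite sumrB mulrBr.
Qed.

Lemma window_polar_vertical s M k : (0 < M)%N -> k != [::] -> is_index k ->
  window_polar (vertical_power s M) (M ^ 2) k = nsum (vrecips R s M) k.
Proof.
move=> M0 k0 ik; rewrite window_identity_at //.
move=> n nw; have [j] := nthP 0 nw; rewrite size_window => jQ <-.
by rewrite nth_window //; apply: vpoint_neq0.
Qed.

(** The symmetric sums of 1/(iM + n)^e are small for e >= 2, and the two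
    choices of sign cancel for e = 1. *)
Lemma central_polar_vertical_tiny k : is_index k ->
  tiny (fun M => central_polar (vertical_power false M) (M ^ 2) k
                 + central_polar (vertical_power true M) (M ^ 2) k).
Proof.
move=> ik; apply: (@tiny_eq R (fun M => \sum_(j < size k) \sum_(h < nth 0%N k j)
  cut C (M ^ 2) (M ^ 2) k j h *
    (\sum_(x <- vrecips R false M) x ^+ (nth 0%N k j - h) +
     \sum_(x <- vrecips R true M) x ^+ (nth 0%N k j - h)))).
  move=> M _; rewrite /central_polar -big_split; apply: eq_bigr => j _ /=.
  rewrite -big_split; apply: eq_bigr => h _ /=.
  by rewrite mulrDr !(vrecips_sum _ _ (fun z : C => z ^+ _)).
apply: tiny_sum => j _; apply: tiny_sum => h _; apply: plog_tiny; first exact: cut_plog.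
have : (0 < nth 0 k j - h)%N by rewrite subn_gt0.
case: (nth 0%N k j - h)%N => [//|[|e]] _.
  apply: tiny_eq (tinyD (vrecips_sum_tiny R false) (vrecips_sum_tiny R true)) => M _ /=.
  rewrite addrACA -opprD [X in _ - X](_ : _ = 0) ?subr0; last first.
    by apply/eqP; rewrite eq_complex /= expr0 expr1 opprK mulN1r mul1r addr0 addNr !eqxx.
  by congr (_ + _); apply: eq_bigr => x _; rewrite expr1.
have t s : tiny (fun M => \sum_(x <- vrecips R s M) x ^+ e.+2).
  apply: (@tiny_norm_le R _ (fun M => \sum_(x <- vrecips R s M) `|x| ^+ e.+2)).
    move=> M _; rewrite [leRHS]ger0_norm; last first.
      by apply: sumr_ge0 => x _; rewrite exprn_ge0.
    by apply: le_trans (ler_norm_sum _ _ _) _; apply: ler_sum => x _; rewrite normrX.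
  exact: index_norm_sum_tiny.
exact: tinyD.
Qed.

(** The differences of residues pair with 1/n^e and with 1/(n + iM)^e up to
    negligible terms; the latter pairing is the nested sum at iM minus the
    symmetric sums, and adding the two signs removes the symmetric ones. *)
Lemma theta_trunc0_tiny k : k != [::] -> is_index k ->
  tiny (fun M => 2%:R * theta_trunc (M ^ 2) 0 k
                 - (nsum (vrecips R false M) k + nsum (vrecips R true M) k)).
Proof.
move=> k0 ik.
have D s : tiny (fun M =>
   (window_polar (laurent_coef 1 0) (M ^ 2) k - nsum (vrecips R s M) k)
   - (central_polar (laurent_coef 1 0) (M ^ 2) k - central_polar (vertical_power s M) (M ^ 2) k)).
  apply: tiny_eq (@window_polar_tiny R
    (fun M n e => laurent_coef 1 0 n e - vertical_power s M n e) k ik _).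
    by move=> M M0; rewrite window_polarB central_polarB window_polar_vertical.
  exact: laurent_vertical_bound.
apply: tiny_eq (tinyB (tinyD (D false) (D true)) (central_polar_vertical_tiny ik)) => M M0 /=.
rewrite theta_truncE // mulr2n mulrDl mul1r.
set w := window_polar _ _ _; set c := central_polar (laurent_coef _ _) _ _.
by ring.
Qed.

Lemma index_all_ones k : is_index k -> ~~ has (leq 2) k -> k = nseq (size k) 1%N.
Proof.
elim: k => //= a k IH /andP[a0 ik]; rewrite negb_or -ltnNge => /andP[a2 hk].
by rewrite -IH //; congr (_ :: _); lia.
Qed.

Lemma iM_pi : ('i * (pi : R)%:C)%C = Complex 0 pi :> C.
Proof. by apply/eqP; rewrite eq_complex /= !mul0r !mul1r subr0 add0r !eqxx. Qed.

(** The two limits (i pi)^r / r! and (-i pi)^r / r! at -iM and iM have mean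
    c0. *)
Theorem theta_trunc_tiny m k : is_index k ->
  tiny (fun M => theta_trunc (M ^ 2) m k - (m == 0%N)%:R * c0 R k).
Proof.
move=> ik; have [->|k0] := eqVneq k [::].
  apply: tiny_eq (tiny0 R) => M _.
  by rewrite theta_trunc_nil /c0 /= fact0 expr0 divr1 mulr1 subrr.
have [m0|m0] := posnP m; last first.
  apply: tiny_eq (theta_trunc_pos_tiny m0 k0 ik) => M _.
  by rewrite mul0r subr0.
rewrite {}m0; have h2 : (2%:R : C) != 0 by rewrite pnatr_eq0.
suff H : tiny (fun M => nsum (vrecips R false M) k + nsum (vrecips R true M) k - 2%:R * c0 R k).
  apply: tiny_eq (tinyMl 2%:R^-1 (tinyD (theta_trunc0_tiny k0 ik) H)) => M _ /=.
  rewrite addrA subrK mul1r -mulrBr mulrA mulVf // mul1r.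
  by [].
have [hk|hk] := boolP (has (leq 2) k).
  apply: tiny_eq (tinyD (nsum_vrecips_tiny R false ik hk) (nsum_vrecips_tiny R true ik hk)) => M _.
  rewrite /c0; case: eqP => [E|_] /=; last by rewrite mulr0 subr0.
  by move: hk; rewrite E has_nseq andbF.
have E := index_all_ones ik hk; set p := size k in E.
apply: tiny_eq (tinyD (nsum_vrecips_ones_tiny R false p)
                      (nsum_vrecips_ones_tiny R true p)) => M _ /=.
rewrite -E addrACA -opprD; congr (_ - _).
rewrite /c0 -/p {1}E eqxx /= iM_pi expr0 expr1 opprK mulN1r mul1r.
have -> : Complex 0 (- pi) = - Complex 0 pi :> C.
  by apply/eqP; rewrite eq_complex /= oppr0 !eqxx.
rewrite exprNn -signr_odd; case: (odd p) => /=.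
  by rewrite expr1 mulN1r mulNr addNr mulr0.
by rewrite expr0 mul1r mulr2n mulrDl mul1r.
Qed.

End TruncatedTheta.

(** * Multiple zeta values as limits of nested sums *)

Section ZetaLimit.
Variable R : realType.
Implicit Types (N Q q d : nat) (a s : seq nat).

(** The subsequences of length d, listed once each when [xs] is duplicate
    free: an enumeration of the summation range of [nsum]. *)
Fixpoint chains (xs : seq nat) d : seq (seq nat) :=
  match xs, d with
  | _, 0 => [:: [::]]
  | [::], _.+1 => [::]
  | x :: xs', d'.+1 => chains xs' d ++ [seq x :: c | c <- chains xs' d']
  end.

Definition chain_term a s : R := \prod_(i < size a) (nth 0%N s i)%:R ^- nth 0%N a i.

Lemma chain_term_ge0 a s : 0 <= chain_term a s.
Proof. by apply: prodr_ge0 => i _; rewrite invr_ge0 exprn_ge0 ?ler0n. Qed.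

Lemma nsum_chains (xs : seq nat) a :
  nsum [seq (n%:R : R)^-1 | n <- xs] a = \sum_(s <- chains xs (size a)) chain_term a s.
Proof.
elim: xs a => [|x xs IH] [|b a] //=.
- by rewrite big_seq1 /chain_term big_ord0.
- by rewrite big_nil.
- by rewrite addr0 big_seq1 nsum_nil /chain_term big_ord0.
rewrite big_cat /= IH; congr (_ + _).
rewrite big_map IH mulr_sumr; apply: eq_bigr => s _.
by rewrite /chain_term big_ord_recl /= exprVn.
Qed.

Lemma mem_chains xs d s : (s \in chains xs d) = subseq s xs && (size s == d).
Proof.
elim: xs d s => [|x xs IH] [|d] [|y s] //=; rewrite ?andbF //.
  by rewrite mem_cat IH sub0seq /=; apply/negbTE/mapP => -[].
rewrite mem_cat IH /= eqSS; case: (eqVneq y x) => [->|yx].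
  rewrite mem_map; last by move=> ? ? [].
  rewrite IH; have [_|_] := eqVneq (size s) d; rewrite ?andbF // !andbT.
  by apply/orP/idP => [[/cons_subseq //|//]|->]; right.
rewrite [X in _ || X](_ : _ = false) ?orbF //.
by apply/negbTE/mapP => -[t _ [/eqP]]; rewrite (negbTE yx).
Qed.

Lemma uniq_chains xs d : uniq xs -> uniq (chains xs d).
Proof.
elim: xs d => [|x xs IH] [|d] //= /andP[xxs uxs].
rewrite cat_uniq IH // map_inj_uniq ?IH //; last by move=> ? ? [].
rewrite andbT; apply/hasPn => _ /mapP[s _ ->] /=.
rewrite mem_chains negb_and; apply/orP; left; apply: contra xxs => sx.
by apply: (mem_subseq sx); rewrite mem_head.
Qed.

Lemma subseq_iota m N s : subseq s (iota m.+1 N) = path ltn m s && all (fun x => x <= m + N)%N s.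
Proof.
apply/idP/andP => [sub|[]].
  split; first by apply: (subseq_path ltn_trans sub); apply: (iota_ltn_sorted m N.+1).
  by apply/allP => x /(mem_subseq sub); rewrite mem_iota addSn ltnS => /andP[].
elim: N m s => [|N IH] m [|x s] //= /andP[mx ps] /andP[xN sN].
  by move: xN; rewrite addn0 leqNgt mx.
have [xm|xm] := eqVneq x m.+1.
  by apply: IH; rewrite -?xm // xm addSnnS.
by apply: (IH m.+1 (x :: s)); rewrite /= ?ps ?addSnnS ?xN ?sN // andbT ltn_neqAle eq_sym xm.
Qed.

Lemma mem_chains_iota N d s :
  (s \in chains (iota 1 N) d) = [&& path ltn 0 s, all (fun x => x <= N)%N s & size s == d].
Proof. by rewrite mem_chains subseq_iota add0n andbA. Qed.

Lemma harm_chains N a :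
  harm R N a = \sum_(s <- chains (iota 1 N) (size a)) chain_term a s.
Proof.
rewrite -nsum_chains /harm /pos_nodes -map_comp; congr nsum.
by rewrite (iotaDl 1 0) -map_comp; apply: eq_map => i.
Qed.

Definition chain_set d : set (seq nat) := [set s | path ltn 0 s /\ size s = d]%classic.

Lemma zeta_esum a :
  zeta R a = fine (\esum_(s in chain_set (size a)) (chain_term a s)%:E).
Proof.
rewrite /zeta; congr fine.
rewrite (@reindex_esum R _ _ [set n : (size a).-tuple nat | path ltn 0%N n]%classic
  (chain_set (size a)) (@tval _ nat)).
  by apply: eq_esum => n _; congr (_%:E); apply: eq_bigr => i _; rewrite (tnth_nth 0%N).
split=> [n|n n' _ _|s [ps ss]] /=.
- by move=> pn; split=> //; apply: size_tuple.
- exact: val_inj.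
- by have /eqP ss' := ss; exists (Tuple ss').
Qed.

Lemma harm_le_esum N a :
  ((harm R N a)%:E <= \esum_(s in chain_set (size a)) (chain_term a s)%:E)%E.
Proof.
apply: esum_ge; exists [set` chains (iota 1 N) (size a)]%classic.
  split; first exact: finite_seq.
  by move=> s /=; rewrite mem_chains_iota => /and3P[ps _ /eqP ss]; split.
by rewrite -fsbig_seq ?uniq_chains ?iota_uniq // sumEFin harm_chains.
Qed.

(** A finite set of chains is contained in those bounded by the sum of all
    their entries. *)
Lemma esum_le_harm a (B : \bar R) : (forall N, ((harm R N a)%:E <= B)%E) ->
  (\esum_(s in chain_set (size a)) (chain_term a s)%:E <= B)%E.
Proof.
move=> hB; apply: ge_ereal_sup => _ /= [F [finF FS] <-].
have /finite_fsetP [A FA] := finF.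
pose N := \sum_(s <- finmap.enum_fset A) sumn s.
apply: le_trans (hB N); rewrite harm_chains -sumEFin [leRHS]fsbig_seq ?uniq_chains ?iota_uniq //.
apply: lee_fsum_nneg_subset => //.
  move=> s; rewrite !inE => Fs; have [ps ss] := FS _ Fs.
  rewrite /= mem_chains_iota ps ss eqxx andbT /=; apply/allP => x xs.
  have sA : s \in finmap.enum_fset A by move: Fs; rewrite FA.
  rewrite /N (big_rem s) //= (leq_trans _ (leq_addr _ _)) //.
  by rewrite sumnE (big_rem x) //= leq_addr.
by move=> s _; rewrite lee_fin chain_term_ge0.
Qed.

(** The step 1/(q + 2) satisfies e^(1/(q+2)) <= (q + 2)/(q + 1). *)
Lemma expR_lgw q : expR (lgw R q.+1) <= expR 2 * q.+1%:R.
Proof.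
elim: q => [|q IH].
  by rewrite mulr1 ler_expR lgwS /lgw harm1E big_ord0 addr0 invr1.
rewrite lgwS expRD; set t := q.+2%:R^-1.
have t1 : 1 - t = q.+1%:R / q.+2%:R.
  have -> : q.+1%:R = q.+2%:R - 1 :> R by rewrite -[q.+2%:R]natr1 addrK.
  by rewrite mulrBl divff ?pnatr_eq0 // mul1r.
have tp : 0 < 1 - t by rewrite t1 divr_gt0 ?ltr0n.
have et : expR t <= q.+2%:R / q.+1%:R.
  rewrite -[leLHS]invrK -expRN -invf_div -t1 lef_pV2 ?posrE ?expR_gt0 //.
  exact: expR_ge1Dx.
apply: le_trans (ler_pM (ltW (expR_gt0 _)) (ltW (expR_gt0 _)) IH et) _.
by rewrite -mulrA ler_wpM2l ?expR_ge0 // mulrCA mulfV ?pnatr_eq0 // mulr1.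
Qed.

Lemma lgw_exp_le n : exists c : nat, forall q, lgw R q ^+ n <= c%:R * q.+1%:R.
Proof.
case: n => [|n]; first by exists 1%N => q; rewrite expr0 mul1r ler1n.
pose b : R := n.+1`!%:R * expR 2.
have b0 : 0 <= b by rewrite mulr_ge0 ?ler0n ?expR_ge0.
exists (Num.bound b) => q.
have l0 : 0 <= lgw R q by apply: lgw_ge0.
have f0 : 0 < n.+1`!%:R :> R by rewrite ltr0n fact_gt0.
have H : lgw R q ^+ n.+1 <= n.+1`!%:R * expR (lgw R q).
  rewrite mulrC -ler_pdivrMr //; apply: le_trans (expR_ge1Dxn n l0).
  by rewrite lerDr.
apply: le_trans H _; apply: (@le_trans _ _ (b * q.+1%:R)); last first.
  by rewrite ler_wpM2r ?ler0n // ltW // archi_boundP.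
rewrite /b -mulrA ler_wpM2l ?ler0n // (le_trans _ (expR_lgw q)) // ler_expR.
exact: le_lgw.
Qed.

Lemma lgw_exp_sqrt n : exists c : nat, forall q, lgw R q ^+ n <= c%:R * Num.sqrt q.+1%:R.
Proof.
have [c H] := lgw_exp_le (n * 2); exists c => q.
have l0 : 0 <= lgw R q ^+ n by rewrite exprn_ge0 // lgw_ge0.
rewrite -(@ler_pXn2r _ 2) ?nnegrE ?mulr_ge0 ?ler0n ?sqrtr_ge0 //.
rewrite -exprM exprMn sqr_sqrtr ?ler0n // (le_trans (H q)) // ler_wpM2r ?ler0n //.
by rewrite -natrX ler_nat; case: (c) => // d; rewrite expnS expn1 leq_pmulr.
Qed.

Lemma harm_ge0 q a : 0 <= harm R q a.
Proof.
rewrite harm_chains; apply: sumr_ge0 => s _; exact: chain_term_ge0.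
Qed.

Lemma harm_le_lgw q a : is_index a -> harm R q a <= lgw R q ^+ size a.
Proof.
move=> ia; rewrite -[leLHS]ger0_norm ?harm_ge0 //.
apply: le_trans (normr_nsum_le _ _) _.
elim: a ia => [|b a IH] /=; first by rewrite big_nil expr0.
case/andP=> b0 ia; rewrite big_cons exprS ler_pM ?IH //.
- by apply: sumr_ge0 => x _; rewrite exprn_ge0.
- by apply: prodr_ge0 => c _; apply: sumr_ge0 => x _; rewrite exprn_ge0.
rewrite big_map /pos_nodes big_map -{1}[q]subn0 -/(index_iota 0 q) big_mkord.
apply: (@le_trans _ _ (\sum_(i < q) i.+1%:R^-1)); last by rewrite -harm1E /lgw lerDr.
apply: ler_sum => i _; rewrite normfV normr_nat -[leRHS]expr1 ler_wiXn2l ?invr_ge0 ?ler0n //.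
by rewrite invf_le1 ?ltr0n // ler1n.
Qed.

Lemma harm_rconsS q a e :
  harm R q.+1 (rcons a e) = harm R q (rcons a e) + harm R q a * q.+1%:R^-1 ^+ e.
Proof. by rewrite /harm pos_nodesS map_rcons nsum_rcons. Qed.

Lemma le_harm q q' a : (q <= q')%N -> harm R q a <= harm R q' a.
Proof.
move=> /subnK <-; elim: (q' - q)%N => // d IH; rewrite addSn (le_trans IH) //.
case/lastP: a {IH} => [|a e]; first by rewrite /harm !nsum_nil.
by rewrite harm_rconsS lerDl mulr_ge0 ?harm_ge0 // exprn_ge0 // invr_ge0 ler0n.
Qed.

(** A telescoping majorant of 1/(q + 1)^(3/2). *)
Lemma inv_sqrt_step (q : nat) : (0 < q)%N ->
  Num.sqrt q.+1%:R * q.+1%:R^-1 ^+ 2 <= 2 * ((Num.sqrt q%:R)^-1 - (Num.sqrt q.+1%:R)^-1) :> R.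
Proof.
move=> q0; set u := Num.sqrt q%:R; set v := Num.sqrt q.+1%:R.
have u0 : 0 < u by rewrite sqrtr_gt0 ltr0n.
have v0 : 0 < v by rewrite sqrtr_gt0 ltr0n.
have v2 : q.+1%:R = v ^+ 2 by rewrite sqr_sqrtr ?ler0n.
have u2 : q%:R = u ^+ 2 by rewrite sqr_sqrtr ?ler0n.
have uv : u <= v by rewrite ler_sqrt ?ltr0n // ler_nat.
have d1 : v ^+ 2 - u ^+ 2 = 1 by rewrite -v2 -u2 -natr1 addrAC subrr add0r.
rewrite v2.
have un0 : u != 0 by rewrite gt_eqF.
have vn0 : v != 0 by rewrite gt_eqF.
have -> : v * (v ^+ 2)^-1 ^+ 2 = (v ^+ 3)^-1 by field.
have suv : 0 < u * v * (u + v) by rewrite !mulr_gt0 // addr_gt0.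
(* Use v^2 - u^2 = 1 to rationalize the difference. *)
have -> : 2 * (u^-1 - v^-1) = 2 * (v ^+ 2 - u ^+ 2) / (u * v * (u + v)).
  by field; rewrite un0 vn0 gt_eqF // addr_gt0.
rewrite d1 mulr1 ler_pdivlMr // mulrC ler_pdivrMr ?exprn_gt0 //.
have -> : 2 * v ^+ 3 = v * v * (v + v) by ring.
by rewrite !ler_pM ?mulr_ge0 ?addr_ge0 ?(ltW u0) ?(ltW v0) // lerD.
Qed.

(** The last exponent is at least 2 and the inner sums grow like logarithms,
    so the terms beyond q are at most of order n^(-3/2). *)
Lemma harm_tail a : admissible a -> a != [::] ->
  exists c : nat, forall q q', (0 < q)%N ->
    harm R q' a <= harm R q a + c%:R / Num.sqrt q%:R.
Proof.
case/lastP: a => [//|a e]; rewrite /admissible is_index_rcons last_rcons.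
case/andP=> /andP[ia _] /orP[E|e2] _; first by case: (a) E.
have [c cP] := lgw_exp_sqrt (size a); exists (c * 2)%N => q q' q0.
have c0 : 0 <= (c * 2)%:R / Num.sqrt q%:R :> R by rewrite divr_ge0 ?ler0n ?sqrtr_ge0.
have [q'q|/ltnW qq'] := leqP q' q; first by rewrite (le_trans (le_harm _ q'q)) // lerDl.
rewrite -lerBlDl.
(* h increases by at least the t-th term, and h <= 0. *)
pose h t : R := - ((c * 2)%:R / Num.sqrt t%:R).
apply: (@le_trans _ _ (h q' - h q)); last first.
  by rewrite /h opprK addrC lerBlDr lerDl divr_ge0 ?ler0n ?sqrtr_ge0.
rewrite -(telescope_sumr (fun t => harm R t (rcons a e)) qq') -(telescope_sumr h qq').
rewrite big_nat_cond [leRHS]big_nat_cond; apply: ler_sum => t /andP[/andP[qt _] _].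
have t0 : (0 < t)%N by apply: leq_trans qt.
rewrite harm_rconsS addrAC subrr add0r.
have -> : h t.+1 - h t = c%:R * (2 * ((Num.sqrt t%:R)^-1 - (Num.sqrt t.+1%:R)^-1)).
  by rewrite /h opprK natrM; ring.
apply: (@le_trans _ _ (c%:R * (Num.sqrt t.+1%:R * t.+1%:R^-1 ^+ 2))); last first.
  by rewrite ler_wpM2l ?ler0n // inv_sqrt_step.
rewrite mulrA ler_pM ?harm_ge0 ?exprn_ge0 ?invr_ge0 ?ler0n //.
  exact: le_trans (harm_le_lgw _ ia) (cP t).
by rewrite ler_wiXn2l ?invr_ge0 ?ler0n // invf_le1 ?ltr0n // ler1n.
Qed.

Lemma zeta_harm_bound a : admissible a ->
  exists c : nat, forall q, (0 < q)%N ->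
    harm R q a <= zeta R a <= harm R q a + c%:R / Num.sqrt q%:R.
Proof.
move=> aa.
have [c cP] : exists c : nat, forall q q', (0 < q)%N ->
    harm R q' a <= harm R q a + c%:R / Num.sqrt q%:R.
  have [->|a0] := eqVneq a [::]; last exact: harm_tail.
  by exists 0%N => q q' _; rewrite /harm !nsum_nil mul0r addr0.
exists c => q q0; rewrite zeta_esum.
set e := esum _ _.
have le1 : ((harm R q a)%:E <= e)%E := harm_le_esum q a.
have le2 : (e <= (harm R q a + c%:R / Num.sqrt q%:R)%:E)%E.
  by apply: esum_le_harm => N; rewrite lee_fin cP.
have fe : e \is a fin_num.
  by rewrite fin_numE -ltNye -ltey (lt_le_trans (ltNyr _) le1) (le_lt_trans le2 (ltry _)).
by rewrite -!lee_fin fineK // le1 le2.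
Qed.

Local Notation C := R[i]%C.

Lemma harm_real q k : harm C q k = (harm R q k)%:C%C.
Proof.
rewrite /harm nsum_rmorph -!map_comp; congr nsum; apply: eq_map => i /=.
by rewrite fmorphV rmorph_nat.
Qed.

Theorem zeta_harm_tiny a : admissible a ->
  tiny (fun M => (zeta R a)%:C%C - harm C (M ^ 2) a).
Proof.
move=> aa; have [c cP] := zeta_harm_bound aa; exists 0%N, c => M M0.
have M20 : (0 < M ^ 2)%N by rewrite expn_gt0 M0.
have /andP[h1 h2] := cP _ M20.
rewrite harm_real -rmorphB normc_def /= expr0n addr0 sqrtr_sqr expr0 mul1r.
rewrite natc_real [X in _ <= _ / X]natc_real -fmorphV -rmorphM lecR.
rewrite ger0_norm ?subr_ge0 // lerBlDl (le_trans h2) //.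
by rewrite natrX sqrtr_sqr normr_nat.
Qed.

Lemma lgs_real M : lgs R M = (lgw R (M ^ 2))%:C%C.
Proof. by rewrite /lgs /lgw harm_real rmorphD rmorph1. Qed.

(** Every power of the logarithm is at most of order M. *)
Lemma tiny_lgs x : tiny (R := R) x ->
  exists c : nat, forall M, (0 < M)%N -> lgs R M * `|x M| <= c%:R.
Proof.
move=> [J [c xc]]; have [d dP] := lgw_exp_sqrt J.+1.
exists (c * (d * 2))%N => M M0.
have l0 : 0 <= lgs R M by rewrite -[lgs R M]expr1 lgsX_ge0.
apply: le_trans (ler_wpM2l l0 (xc M M0)) _.
rewrite natrM mulrCA ler_wpM2l ?ler0n // mulrA -exprS.
rewrite lgs_real ler_pdivrMr ?ltr0n // -rmorphXn natc_real [_ * M%:R in leRHS]mulrC.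
rewrite natc_real -rmorphM lecR (le_trans (dP _)) // natrM mulrCA ler_wpM2l ?ler0n //.
rewrite -(@ler_pXn2r _ 2) ?nnegrE ?mulr_ge0 ?ler0n ?sqrtr_ge0 //.
rewrite sqr_sqrtr ?ler0n // -natrM -natrX ler_nat expnMn.
have : (0 < M ^ 2)%N by rewrite expn_gt0 M0.
by move: (M ^ 2)%N => q q0; lia.
Qed.

End ZetaLimit.

(** * Theta for arbitrary values *)

Section Assembly.
Variable R : realType.
Local Notation C := R[i]%C.
Implicit Types (M Q : nat) (k : seq nat) (Z : seq nat -> C) (z : nat -> C).

Definition gen_A Z m k : C :=
  \sum_(j < (size k).+1)
     (-1) ^+ sumn (take j k) *
     \sum_(a < m.+1) (-1) ^+ a * shift_coef Z a (rev (take j k))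
                       * shift_coef Z (m - a) (drop j k).

Definition gen_B Z j m k : C :=
  (-1) ^+ sumn (take j.-1 k) *
  \sum_(a < m.+1) (-1) ^+ a * shift_coef Z a (rev (take j.-1 k))
                    * shift_coef Z (m - a) (drop j k).

Definition gen_mu z m e : C :=
  if (1 < e + m)%N then
    (1 + (-1) ^+ (e + m)) * gbinom (- e%:R) m * z (e + m)%N
  else 0.

(** The expression defining Theta, the regularized multiple zeta values
    entering the products being replaced by [Z] and the single zeta values
    entering mu by [z]. *)
Definition gen_Theta Z z m k : C :=
  gen_A Z m k
  + \sum_(1 <= j < (size k).+1) gen_B Z j (nth 0%N k j.-1 + m) k
  - \sum_(1 <= j < (size k).+1) \sum_(0 <= h < nth 0%N k j.-1)
      gen_B Z j h k * gen_mu z m (nth 0%N k j.-1 - h).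

Lemma Theta_gen (T : C) m k :
  Theta T m k = gen_Theta (zeta_star T) (fun n => (zeta R [:: n])%:C%C) m k.
Proof. by []. Qed.

(** * The truncated expression *)

Lemma hurwitz_shift_coef q b k : hurwitz C q k b = shift_coef (harm C q) b k.
Proof. by rewrite shift_coefE hurwitz_coef. Qed.

Lemma gen_A_harm Q m k :
  gen_A (harm C Q) m k = nsum (map (@yinv C) (neg_nodes C Q ++ pos_nodes C Q)) k m.
Proof.
rewrite map_cat nsum_cat fps_sumE; apply: eq_bigr => j _.
rewrite hurwitz_neg -mulrA fps_signM; congr (_ * _).
rewrite -/(hurwitz C Q (drop j k)) fpsME; apply: eq_bigr => a _.
by rewrite -!hurwitz_shift_coef.
Qed.

Lemma gen_B_harm Q j m k : gen_B (harm C Q) j.+1 m k = cut C Q Q k j m.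
Proof. by rewrite cutE; congr (_ * _); apply: eq_bigr => a _; rewrite -!hurwitz_shift_coef. Qed.

Lemma harm_single Q n : harm C Q [:: n] = \sum_(x <- pos_nodes C Q) x^-1 ^+ n.
Proof.
rewrite /harm; elim: (pos_nodes C Q) => [|x xs IH]; first by rewrite big_nil.
by rewrite map_cons nsum_cons nsum_nil mulr1 big_cons IH addrC.
Qed.

(** Opposite nodes give the factor 1 + (-1)^(e+m), which vanishes when
    e + m = 1, the case excluded from the definition of mu. *)
Lemma gen_mu_harm Q m e : (0 < e)%N ->
  gen_mu (fun n => harm C Q [:: n]) m e =
  \sum_(i < (Q + Q).+1) laurent_coef 1 m (i%:R - Q%:R) e.
Proof.
move=> e0.
have -> : \sum_(i < (Q + Q).+1) laurent_coef 1 m (i%:R - Q%:R : C) e =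
          \sum_(x <- window C Q) laurent_coef 1 m x e.
  rewrite [RHS](big_nth 0) size_window big_mkord; apply: eq_bigr => i _.
  by rewrite nth_window.
rewrite /window big_cat big_cons /= {2}/laurent_coef eqxx fps1E addn_eq0.
rewrite (gtn_eqF e0) andbF add0r.
have pos0 (x : C) : x \in pos_nodes C Q -> x != 0.
  by case/mapP=> i _ ->; rewrite pnatr_eq0.
have lc (x : C) : x != 0 -> laurent_coef 1 m x e = gbinom (- e%:R) m * x^-1 ^+ (e + m).
  by move=> x0; rewrite /laurent_coef (negbTE x0) mul1r yinv_exp_coef.
have -> : \sum_(x <- neg_nodes C Q) laurent_coef 1 m x e =
    (-1) ^+ (e + m) * gbinom (- e%:R) m * harm C Q [:: (e + m)%N].
  rewrite harm_single /neg_nodes (perm_big _ (permEl (perm_rev _))) big_map mulr_sumr.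
  rewrite big_seq [RHS]big_seq; apply: eq_bigr => x /pos0 x0.
  by rewrite lc ?oppr_eq0 // invrN (exprNn x^-1) mulrCA mulrA.
have -> : \sum_(x <- pos_nodes C Q) laurent_coef 1 m x e =
    gbinom (- e%:R) m * harm C Q [:: (e + m)%N].
  rewrite harm_single mulr_sumr big_seq [RHS]big_seq; apply: eq_bigr => x /pos0 x0.
  exact: lc.
rewrite /gen_mu; case: ltnP => [_|em]; first by ring.
have -> : (e + m = 1)%N by lia.
by rewrite expr1 mulN1r mulNr addNr.
Qed.

Lemma gen_Theta_harm Q m k :
  gen_Theta (harm C Q) (fun n => harm C Q [:: n]) m k = theta_trunc R Q m k.
Proof.
rewrite /gen_Theta /theta_trunc gen_A_harm !big_add1 !big_mkord /central_polar.
congr (_ + _ - _).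
  by apply: eq_bigr => j _; rewrite gen_B_harm addnC.
apply: eq_bigr => j _; rewrite big_mkord; apply: eq_bigr => h _.
by rewrite gen_B_harm gen_mu_harm // subn_gt0.
Qed.

(** * Comparing regularized and truncated values *)

(** Boundedness by logarithms makes the relation compatible with products. *)
Definition close (x y : nat -> C) := tiny (fun M => x M - y M) /\ plog y.

Lemma close_eq (x x' y y' : nat -> C) :
  (forall M, x M = x' M) -> (forall M, y M = y' M) -> close x y -> close x' y'.
Proof.
move=> ex ey [t p]; split; first by apply: tiny_eq t => M _; rewrite ex ey.
by apply: plog_eq p => M _.
Qed.

Lemma close_plog x y : close x y -> plog x.
Proof.
move=> [t p]; apply: plog_eq (plogD (tinyW_plog t) p) => M _; by rewrite subrK.
Qed.

Lemma close_const c : close (fun=> c) (fun=> c).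
Proof.
split; last exact: plog_const.
by apply: tiny_eq (tiny0 R) => M _; rewrite subrr.
Qed.

Lemma closeD x y x' y' : close x x' -> close y y' ->
  close (fun M => x M + y M) (fun M => x' M + y' M).
Proof.
move=> [tx px] [ty py]; split; last exact: plogD.
by apply: tiny_eq (tinyD tx ty) => M _; rewrite opprD addrACA.
Qed.

Lemma closeM x y x' y' : close x x' -> close y y' ->
  close (fun M => x M * y M) (fun M => x' M * y' M).
Proof.
move=> cx cy; have px := close_plog cx; case: cx cy => [tx px'] [ty py']; split; last exact: plogM.
apply: tiny_eq (tinyD (tiny_plog tx py') (plog_tiny px ty)) => M _ /=.
by rewrite mulrBl mulrBr addrC addrA subrK.
Qed.

Lemma closeMc c x x' : close x x' -> close (fun M => c * x M) (fun M => c * x' M).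
Proof. exact/closeM/close_const. Qed.

Lemma closeN x x' : close x x' -> close (fun M => - x M) (fun M => - x' M).
Proof. by move=> cx; apply: close_eq (closeMc (-1) cx) => M; rewrite mulN1r. Qed.

Lemma close_sum (I : Type) (r : seq I) (P : pred I) (x y : I -> nat -> C) :
  (forall i, P i -> close (x i) (y i)) ->
  close (fun M => \sum_(i <- r | P i) x i M) (fun M => \sum_(i <- r | P i) y i M).
Proof.
move=> H; split; last by apply: plog_sum => i /H [].
apply: (@tiny_eq R (fun M => \sum_(i <- r | P i) (x i M - y i M))).
  by move=> M _; rewrite sumrB.
by apply: tiny_sum => i /H [].
Qed.

Lemma closeX x x' n : close x x' -> close (fun M => x M ^+ n) (fun M => x' M ^+ n).
Proof.
move=> cx; elim: n => [|n IH]; first exact: close_const.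
by apply: close_eq (closeM cx IH) => M; rewrite exprS.
Qed.

Lemma close_shift (Z Z' : nat -> seq nat -> C) b k :
    (forall w, is_index w -> close (Z^~ w) (Z'^~ w)) -> is_index k ->
  close (fun M => shift_coef (Z M) b k) (fun M => shift_coef (Z' M) b k).
Proof.
move=> H ik; apply: close_sum => lam _; apply: closeMc; apply: H.
apply/allP => n /mapP[i _ ->]; rewrite addn_gt0.
by rewrite (allP ik) ?orTb // mem_nth.
Qed.

Lemma close_gen_Theta (Z Z' : nat -> seq nat -> C) (z z' : nat -> nat -> C) m k :
    (forall w, is_index w -> close (Z^~ w) (Z'^~ w)) ->
    (forall n, (1 < n)%N -> close (z^~ n) (z'^~ n)) -> is_index k ->
  close (fun M => gen_Theta (Z M) (z M) m k) (fun M => gen_Theta (Z' M) (z' M) m k).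
Proof.
move=> HZ Hz ik.
have cs b n : close (fun M => shift_coef (Z M) b (rev (take n k)))
                    (fun M => shift_coef (Z' M) b (rev (take n k))).
  by apply: close_shift => //; rewrite is_index_rev is_index_take.
have cd b n : close (fun M => shift_coef (Z M) b (drop n k))
                    (fun M => shift_coef (Z' M) b (drop n k)).
  by apply: close_shift => //; rewrite is_index_drop.
have cB j n : close (fun M => gen_B (Z M) j n k) (fun M => gen_B (Z' M) j n k).
  by apply/closeMc/close_sum => a _; apply: closeM => //; apply: closeMc.
apply: closeD; last first.
  apply/closeN/close_sum => j _; apply: close_sum => h _; apply: closeM => //.
  rewrite /gen_mu; case em: (1 < nth 0%N k j.-1 - h + m)%N; last exact: close_const.
  exact/closeMc/Hz.
apply: closeD; last by apply: close_sum.
apply: close_sum => j _; apply/closeMc/close_sum => a _.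
by apply: closeM => //; apply: closeMc.
Qed.

Lemma harm_plog k : is_index k -> plog (fun M => harm C (M ^ 2) k).
Proof.
move=> ik; exists (size k), 1%N => M _; rewrite mul1r harm_real lgs_real -rmorphXn.
by rewrite normc_def /= expr0n addr0 sqrtr_sqr lecR ger0_norm ?harm_ge0 // harm_le_lgw.
Qed.

(** The value of the parameter at which regularized and truncated values are
    compared. *)
Definition tau M : C := harm C (M ^ 2) [:: 1%N].

Lemma zeta_close a : admissible a -> close (fun=> (zeta R a)%:C%C) (fun M => harm C (M ^ 2) a).
Proof.
move=> aa; split; first exact: zeta_harm_tiny.
by apply: harm_plog; case/andP: aa.
Qed.

Lemma zeta_span_eval u : (zeta_span R u)%:C%C = span_eval (fun w => (zeta R w)%:C%C) u.
Proof.
rewrite /zeta_span rmorph_sum; apply: eq_bigr => w _.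
by rewrite rmorphM fmorph_rat.
Qed.

(** Both sides are polynomials in [tau M], with coefficients zeta(u_l) and
    their truncations. *)
Lemma zeta_star_close k : is_index k ->
  close (fun M => zeta_star (tau M) k) (fun M => harm C (M ^ 2) k).
Proof.
move=> ik; have [adm _] := stuffle_decompositionP ik.
apply: (@close_eq (fun M => zeta_star (tau M) k) _ (fun M => \sum_(l < (size k).+1)
    span_eval (harm C (M ^ 2)) (stuffle_decomposition k l) * tau M ^+ l)) => //.
  by move=> M; rewrite /harm [RHS]nsum_decomposition.
apply: close_sum => l _; apply: closeM; last first.
  by apply: closeX; split; [apply: tiny_eq (tiny0 R) => M _; rewrite subrr|exact: harm_plog].
rewrite zeta_span_eval.
apply: (@close_eq (fun M => \sum_(w <- dom (stuffle_decomposition k l) |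
     w \in dom (stuffle_decomposition k l))
     ratr (coeff w (stuffle_decomposition k l)) * (zeta R w)%:C%C) _
   (fun M => \sum_(w <- dom (stuffle_decomposition k l) |
     w \in dom (stuffle_decomposition k l))
     ratr (coeff w (stuffle_decomposition k l)) * harm C (M ^ 2) w)).
- by move=> M; rewrite -big_seq.
- by move=> M; rewrite -big_seq.
apply: close_sum => w wd; apply/closeMc/zeta_close.
by move/allP: (adm l); apply.
Qed.

(** * Dependence on the regularization parameter *)

Definition polynomial_fun (f : C -> C) := exists p : {poly C}, forall T, f T = p.[T].

Lemma polyfun_const c : polynomial_fun (fun=> c).
Proof. by exists c%:P => T; rewrite hornerC. Qed.

Lemma polyfunD f g : polynomial_fun f -> polynomial_fun g -> polynomial_fun (fun T => f T + g T).
Proof. by move=> [p fp] [q gq]; exists (p + q) => T; rewrite fp gq hornerD. Qed.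

Lemma polyfunM f g : polynomial_fun f -> polynomial_fun g -> polynomial_fun (fun T => f T * g T).
Proof. by move=> [p fp] [q gq]; exists (p * q) => T; rewrite fp gq hornerM. Qed.

Lemma polyfunMc c f : polynomial_fun f -> polynomial_fun (fun T => c * f T).
Proof. exact/polyfunM/polyfun_const. Qed.

Lemma polyfunN f : polynomial_fun f -> polynomial_fun (fun T => - f T).
Proof. by move=> [p fp]; exists (- p) => T; rewrite fp hornerN. Qed.

Lemma polyfun_sum (I : Type) (r : seq I) (P : pred I) (f : I -> C -> C) :
  (forall i, P i -> polynomial_fun (f i)) -> polynomial_fun (fun T => \sum_(i <- r | P i) f i T).
Proof.
move=> H; elim: r => [|i r [p IH]].
  by exists 0 => T; rewrite big_nil horner0.
have [/[dup] Pi /H [q fq]|Pi] := boolP (P i).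
  by exists (q + p) => T; rewrite big_cons Pi fq IH hornerD.
by exists p => T; rewrite big_cons (negbTE Pi) IH.
Qed.

Lemma polyfun_zeta_star k : polynomial_fun (fun T : C => zeta_star T k).
Proof.
apply: polyfun_sum => l _; apply: polyfunMc; exists ('X^l) => T.
by rewrite hornerXn.
Qed.

Lemma polyfun_Theta m k : polynomial_fun (fun T : C => Theta T m k).
Proof.
have ps b w : polynomial_fun (fun T : C => zeta_star_m T b w).
  by apply: polyfun_sum => lam _; apply/polyfunMc/polyfun_zeta_star.
have pB j n : polynomial_fun (fun T : C => theta_B T j n k).
  by apply/polyfunMc/polyfun_sum => a _; apply: polyfunM => //; apply: polyfunMc.
apply: polyfunD; last first.
  apply/polyfunN/polyfun_sum => j _; apply: polyfun_sum => h _; apply: polyfunM => //.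
  exact: polyfun_const.
apply: polyfunD; last by apply: polyfun_sum.
apply: polyfun_sum => j _; apply/polyfunMc/polyfun_sum => a _.
by apply: polyfunM => //; apply: polyfunMc.
Qed.

(** Each doubling of the range adds at least 1/2. *)
Lemma lgw_unbounded n : 1 + n%:R / 2 <= lgw R (2 ^ n).
Proof.
elim: n => [|n IH]; first by rewrite mul0r addr0 lgw_ge1.
rewrite expnS mul2n -addnn; set q := (2 ^ n)%N in IH *.
have q0 : (0 < q)%N by rewrite expn_gt0.
have -> : lgw R (q + q) = lgw R q + \sum_(i < q) (q + i).+1%:R^-1.
  by rewrite /lgw !harm1E big_split_ord addrA.
rewrite -natr1 mulrDl addrA lerD //.
apply: (@le_trans _ _ (\sum_(i < q) (q + q)%N%:R^-1)).
  rewrite sumr_const card_ord -[leRHS]mulr_natl natrD.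
  have q0' : (q%:R : R) != 0 by rewrite pnatr_eq0 -lt0n.
  rewrite le_eqVlt; apply/orP; left; apply/eqP.
  move: (q%:R : R) q0' => x x0; have -> : x + x = x * 2 by ring.
  by rewrite invfM mulrA divff.
by apply: ler_sum => i _; rewrite lef_pV2 ?posrE ?ltr0n ?addn_gt0 ?q0 // ler_nat ltn_add2l.
Qed.

Lemma lgs_unbounded (x : C) : exists M, (0 < M)%N /\ ~~ (lgs R M <= x).
Proof.
have [n xn] := normc_nat_bound x; exists (2 ^ n)%N; split; first by rewrite expn_gt0.
apply/negP => lx.
have x0 : 0 <= x by apply: le_trans lx; rewrite -[lgs _ _]expr1 lgsX_ge0.
move: (le_trans lx (le_trans (real_ler_norm (ger0_real x0)) xn)).
rewrite lgs_real natc_real lecR -expnM => H.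
have := le_trans (lgw_unbounded (n * 2)) H.
by rewrite natrM mulfK ?pnatr_eq0 // gerDr ler10.
Qed.

(** The parameter is unbounded, so a nonzero polynomial in it stays away from
    0 and cannot be smaller than its inverse. *)
Lemma tiny_poly_eq0 (p : {poly C}) : tiny (fun M => p.[tau M]) -> p = 0.
Proof.
move=> tp; pose r := p \Po ('X - 1%:P).
have rE M : r.[lgs R M] = p.[tau M].
  by rewrite horner_comp !hornerE /lgs /lgw addrC addKr.
(* In terms of lgs = 1 + tau >= 1, the leading term of r dominates. *)
suff r0 : r = 0.
  have -> : p = r \Po ('X + 1%:P).
    by rewrite -comp_polyA comp_polyB comp_polyX comp_polyC addrK comp_polyXr.
  by rewrite r0 comp_poly0.
apply/eqP/negPn/negP => rn0; have [c Hc] := tiny_lgs tp.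
have a0 : 0 < `|lead_coef r| by rewrite normr_gt0 lead_coef_eq0.
pose B := c%:R + \sum_(i < (size r).-1) `|r`_i|.
have [M [M0]] := lgs_unbounded (B / `|lead_coef r|); case/negP.
have l1 : 1 <= lgs R M by apply: lgw_ge1.
have l0 : 0 < lgs R M by apply: lt_le_trans l1.
rewrite ler_pdivlMr // mulrC -(@ler_pM2r _ (lgs R M ^+ (size r).-1)) ?exprn_gt0 //.
have E : lead_coef r * lgs R M ^+ (size r).-1 =
    r.[lgs R M] - \sum_(i < (size r).-1) r`_i * lgs R M ^+ i.
  rewrite horner_coef lead_coefE; have := rn0; rewrite -size_poly_gt0.
  by case: (size r) => // n _; rewrite big_ord_recr /= addrAC subrr add0r.
rewrite mulrAC -[X in _ * X]ger0_norm ?(ltW l0) //.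
rewrite -{1}[lgs R M ^+ _]ger0_norm ?exprn_ge0 ?(ltW l0) // -normrM E.
rewrite [`|lgs R M|]ger0_norm ?(ltW l0) //.
apply: le_trans (ler_wpM2r (ltW l0) (ler_normB _ _)) _.
rewrite mulrDl [B]/(_ + _) mulrDl rE mulrC lerD //.
  by apply: le_trans (Hc M M0) _; rewrite ler_peMr ?ler0n // exprn_ege1.
apply: le_trans (ler_wpM2r (ltW l0) (ler_norm_sum _ _ _)) _.
rewrite !mulr_suml; apply: ler_sum => i _.
rewrite normrM normrX (ger0_norm (ltW l0)) -mulrA -exprSr ler_wpM2l //.
by rewrite ler_weXn2l.
Qed.

End Assembly.

Local Open Scope complex_scope.

Theorem theorem6p9 (R : realType) (k : seq nat) (m : nat) (T : R[i])
    (hk : is_index k) :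
  Theta T m k = (m == 0%N)%:R * c0 R k.
Proof.
have [p pE] := polyfun_Theta R m k.
suff : p - ((m == 0%N)%:R * c0 R k)%:P = 0.
  move/(congr1 (fun q : {poly _} => q.[T])); rewrite pE !hornerE => /eqP.
  by rewrite subr_eq0 => /eqP.
apply: tiny_poly_eq0.
have [t _] : close (fun M => gen_Theta (zeta_star (tau R M)) (fun n => (zeta R [:: n])%:C%C) m k)
    (fun M => gen_Theta (harm R[i]%C (M ^ 2)) (fun n => harm R[i]%C (M ^ 2) [:: n]) m k).
  apply: close_gen_Theta hk => [w iw|n n1]; first exact: zeta_star_close.
  by apply: zeta_close; rewrite /admissible /= n1 (ltnW n1).
apply: tiny_eq (tinyD t (theta_trunc_tiny R m hk)) => M _ /=.
by rewrite -gen_Theta_harm -Theta_gen addrA subrK pE !hornerE.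
Qed.
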